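(* Let $n\ge 1$. The maps \begin{align*} &\pi f\colon \mathrm{VR}^m(\mathbb{RP}^n;r)\to\mathbb{RP}^n\quad\text{for } r<\tfrac16,\\ &\pi f\colon \mathrm{VR}^m_<(\mathbb{RP}^n;\tfrac16)\to\mathbb{RP}^n,\\ &\pi f\colon \mathrm{VR}^m_\le(\mathbb{RP}^n;\tfrac16)\setminus W\to\mathbb{RP}^n \end{align*} are homotopy equivalences. (In the first line, $\mathrm{VR}^m$ stands for either $\mathrm{VR}^m_<$ or $\mathrm{VR}^m_\le$.)
   Context: Spaces. $S^n\subseteq\mathbb{R}^{n+1}$ is the unit sphere with the geodesic metric rescaled so that every great circle has circumference $1$. $\mathbb{RP}^n=S^n/(x\sim -x)$ has the quotient metric $d_{\mathbb{RP}^n}([x],[x'])=\min\{d_{S^n}(x,x'),d_{S^n}(x,-x')\}$, where $[x]=\pm x$; so a great circle of $\mathbb{RP}^n$ (the image of a great circle of $S^n$) has circumference $\tfrac12$. Metric thickenings. For a metric space $Y$ and $r\ge0$, $\mathrm{VR}^m_\le(Y;r)$ (resp. $\mathrm{VR}^m_<(Y;r)$) is the set of finitely supported probability measures $\sum_{i=0}^k\lambda_i\delta_{y_i}$ (written $\sum\lambda_i y_i$) whose support $\{y_0,\dots,y_k\}$ is a simplex of the Vietoris--Rips complex with vertex set $Y$, i.e. is a single point or has all pairwise distances $\le r$ (resp. $<r$); it is equipped with the 1-Wasserstein metric. The set $W$. $W\subseteq \mathrm{VR}^m_\le(\mathbb{RP}^n;\tfrac16)$ is the set of all points $\sum_{i=0}^2\lambda_i[x_i]$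 with all $\lambda_i>0$ and $\{[x_0],[x_1],[x_2]\}$ the vertices of an equilateral $2$-simplex inscribed in a great circle of $\mathbb{RP}^n$ (three evenly spaced points on a great circle). The map $\pi f$. Let $f\colon \mathrm{VR}^m(S^n;r)\to\mathbb{R}^{n+1}$ send the formal convex combination $\sum\lambda_i x_i$ to the actual linear combination $\sum\lambda_i x_i\in\mathbb{R}^{n+1}$, and let $\pi\colon\mathbb{R}^{n+1}\setminus\{\vec 0\}\to S^n$ be radial projection. For the scales in question the image of $f$ misses the origin, giving $\pi f\colon \mathrm{VR}^m(S^n;r)\to S^n$, which commutes with the antipodal actions, where on $\mathrm{VR}^m(S^n;r)$ one has $\sum\lambda_i x_i\mapsto\sum\lambda_i(-x_i)$; let $\sim$ denote the resulting equivalence relation. The assignment $[\sum\lambda_i x_i]\mapsto\sum\lambda_i[x_i]$ gives homeomorphisms $\mathrm{VR}^m(S^n;r)/{\sim}\cong\mathrm{VR}^m(\mathbb{RP}^n;r)$ for $r<\tfrac16$, $\mathrm{VR}^m_<(S^n;\tfrac16)/{\sim}\cong\mathrm{VR}^m_<(\mathbb{RP}^n;\tfrac16)$ and $\mathrm{VR}^m_\le(S^n;\tfrac16)/{\sim}\cong\mathrm{VR}^m_\le(\mathbb{RP}^n;\tfrac16)\setminus W$. By abuse of notation, $\pi f$ also denotes the composite of the inverse of such a homeomorphism with the map to $S^n/{\sim}=\mathbb{RP}^n$ induced by $\pi f$ on quotients. Concretely, $\pi f(\sum\lambda_i[x_i])=[\pi(\sum\lambda_i x_i)]$ when the representatives $x_i\in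 S^n$ are chosen so that all pairwise distances $d_{S^n}(x_i,x_j)$ satisfy the same bound ($\le r$ or $<r$) as in $\mathbb{RP}^n$. *)

(* Defs.v *)
From HB Require Import structures.
From mathcomp Require Import all_boot all_order all_algebra generic_quotient finmap.
From mathcomp Require Import all_classical all_reals all_analysis.
From mathcomp Require Import ring lra.

Set Implicit Arguments.
Unset Strict Implicit.
Unset Printing Implicit Defensive.

Import Order.TTheory GRing.Theory Num.Theory.
Import numFieldNormedType.Exports.

Local Open Scope classical_set_scope.
Local Open Scope ring_scope.

Section Homotopy.
Context (R : realType).

Definition homotopic (X Y : topologicalType) (f g : X -> Y) : Prop :=
  exists H : X * R -> Y,
    [/\ {within [set: X] `*` `[0, 1], continuous H},
        forall x, H (x, 0) = f x & forall x, H (x, 1) = g x].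

Definition homotopy_equivalence (X Y : topologicalType) (f : X -> Y) : Prop :=
  continuous f /\
  exists g : Y -> X,
    [/\ continuous g, homotopic (g \o f) id & homotopic (f \o g) id].

End Homotopy.

Section FiniteSupport.
Context (R : realType).

Section Measure.
Context (T : choiceType).

Record fsprob := FSProb {
  fsprob_fun :> {fsfun T -> R with 0} ;
  _ : all (fun y => 0 <= fsprob_fun y) (finsupp fsprob_fun) &&
      (\sum_(y <- finsupp fsprob_fun) fsprob_fun y == 1)
}.

HB.instance Definition _ := [isSub for fsprob_fun].
HB.instance Definition _ := [Choice of fsprob by <:].

Implicit Types (mu nu : fsprob).

Lemma fsprob_ge0 mu y : 0 <= mu y.
Proof.
case: mu => m /= /andP[/allP m0 _].
by case: finsuppP => // ym; exact: m0.
Qed.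

Lemma fsprob_sum1 mu : \sum_(y <- finsupp mu) mu y = 1.
Proof. by case: mu => m /= /andP[_ /eqP]. Qed.

Lemma fsprobP mu nu : mu =1 nu -> mu = nu.
Proof. by move=> e; apply/val_inj/fsfunP. Qed.

Definition expect mu (g : T -> R) : R := \sum_(y <- finsupp mu) mu y * g y.

End Measure.

(* The measure \sum_(i <- s) w i *: \delta_(h i); the points h i may repeat. *)
Section Combination.
Context (I T : choiceType) (s : seq I) (w : I -> R) (h : I -> T).

Definition comb_fun : {fsfun T -> R with 0} :=
  [fsfun y in [fset h i | i in s]%fset => \sum_(i <- s | h i == y) w i | 0].

Lemma comb_funE y : comb_fun y = \sum_(i <- s | h i == y) w i.
Proof.
rewrite fsfun_fun; case: ifPn => // /imfsetP yNs.
rewrite big_seq_cond big1// => i /andP[si /eqP hi].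
by case: yNs; exists i.
Qed.

Lemma expect_comb_fun (g : T -> R) :
  \sum_(y <- finsupp comb_fun) comb_fun y * g y = \sum_(i <- s) w i * g (h i).
Proof.
set A := [fset h i | i in s]%fset.
have sA : (finsupp comb_fun `<=` A)%fset.
  apply/fsubsetP => y; rewrite mem_finsupp fsfun_fun.
  by case: ifPn => //; rewrite eqxx.
rewrite (big_fset_incl _ sA); last first.
  by move=> y _ /fsfun_dflt ->; rewrite mul0r.
under eq_bigr do rewrite comb_funE mulr_suml big_mkcond.
rewrite exchange_big/= big_seq [RHS]big_seq; apply: eq_bigr => i si.
rewrite -big_mkcond/= (big_rem (h i))/=; last first.
  by apply/imfsetP; exists i.
rewrite eqxx big_seq_cond big1 ?addr0// => y /andP[].
by rewrite mem_rem_uniq ?fset_uniq// !inE eq_sym => /andP[/negPf ->].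
Qed.

Hypothesis w_ge0 : forall i, i \in s -> 0 <= w i.
Hypothesis w_sum1 : \sum_(i <- s) w i = 1.

Lemma comb_subproof : all (fun y => 0 <= comb_fun y) (finsupp comb_fun) &&
  (\sum_(y <- finsupp comb_fun) comb_fun y == 1).
Proof.
apply/andP; split.
  apply/allP => y _; rewrite comb_funE big_seq_cond sumr_ge0// => i /andP[si _].
  exact: w_ge0.
have := expect_comb_fun (fun=> 1).
under eq_bigr do rewrite mulr1.
by move=> ->; under eq_bigr do rewrite mulr1; rewrite w_sum1.
Qed.

Definition comb : fsprob T := FSProb comb_subproof.

Lemma combE y : comb y = \sum_(i <- s | h i == y) w i.
Proof. exact: comb_funE. Qed.

Lemma expect_comb (g : T -> R) : expect comb g = \sum_(i <- s) w i * g (h i).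
Proof. exact: expect_comb_fun. Qed.

End Combination.

Lemma expect_indic (T : choiceType) (mu : fsprob T) y :
  expect mu (fun x => (x == y)%:R) = mu y.
Proof.
rewrite /expect; case: (finsuppP mu y) => [ymu|ymu].
  rewrite big_seq big1// => x xmu; case: eqP => [xy|]; rewrite ?mulr0//.
  by rewrite -xy xmu in ymu.
rewrite (big_rem y)//= eqxx mulr1 big_seq big1 ?addr0// => x.
by rewrite mem_rem_uniq ?fset_uniq// !inE => /andP[/negPf ->]; rewrite mulr0.
Qed.

Lemma expect_inj (T : choiceType) (mu nu : fsprob T) :
  (forall g, expect mu g = expect nu g) -> mu = nu.
Proof. by move=> e; apply: fsprobP => y; rewrite -!expect_indic. Qed.

Section Pushforward.
Context (T U : choiceType) (q : T -> U) (mu : fsprob T).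

Lemma pushforward_ge0 x : x \in finsupp mu -> 0 <= mu x.
Proof. by move=> _; exact: fsprob_ge0. Qed.

Definition pushforward : fsprob U := comb q pushforward_ge0 (fsprob_sum1 mu).

Lemma expect_pushforward g : expect pushforward g = expect mu (g \o q).
Proof. exact: expect_comb. Qed.

End Pushforward.

Definition coupling (T : choiceType) (mu nu : fsprob T) : set (fsprob (T * T)%type) :=
  [set P | pushforward fst P = mu /\ pushforward snd P = nu].

Section Wasserstein.
Context (Y : metricType R).
Implicit Types (mu nu rho : fsprob Y) (P Q : fsprob (Y * Y)%type).

Definition cost P : R := expect P (fun z => mdist z.1 z.2).

Definition wasserstein mu nu : R := inf (cost @` coupling mu nu).

Lemma cost_ge0 P : 0 <= cost P.
Proof. by apply: sumr_ge0 => z _; rewrite mulr_ge0 ?fsprob_ge0 ?mdist_ge0. Qed.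

Lemma prod_weight_sum1 mu nu :
  \sum_(z <- [seq (x, y) | x <- finsupp mu, y <- finsupp nu]) mu z.1 * nu z.2 = 1.
Proof.
rewrite big_allpairs_dep/=.
under eq_bigr do rewrite -mulr_sumr fsprob_sum1 mulr1.
exact: fsprob_sum1.
Qed.

Lemma coupling_nonempty mu nu : coupling mu nu !=set0.
Proof.
pose s := [seq (x, y) | x <- finsupp mu, y <- finsupp nu].
have w0 (z : Y * Y) : z \in s -> 0 <= mu z.1 * nu z.2.
  by rewrite mulr_ge0 ?fsprob_ge0.
exists (comb id w0 (prod_weight_sum1 mu nu)); split; apply: expect_inj => g;
  rewrite expect_pushforward expect_comb big_allpairs_dep/=.
- apply: eq_bigr => x _; rewrite -mulr_suml -mulr_sumr fsprob_sum1 mulr1//.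
- rewrite exchange_big/=; apply: eq_bigr => y _.
  by rewrite -!mulr_suml fsprob_sum1 mul1r.
Qed.

Lemma has_inf_cost mu nu : has_inf (cost @` coupling mu nu).
Proof.
split; first by have [P cP] := coupling_nonempty mu nu; exists (cost P), P.
by exists 0 => _ [P _ <-]; exact: cost_ge0.
Qed.

Lemma wasserstein_le mu nu P : coupling mu nu P -> wasserstein mu nu <= cost P.
Proof.
by move=> cP; apply: ge_inf; [exact: (has_inf_cost mu nu).2|exists P].
Qed.

Lemma le_wasserstein mu nu (a : R) :
  (forall P, coupling mu nu P -> a <= cost P) -> a <= wasserstein mu nu.
Proof.
move=> aP; apply: lb_le_inf; first exact: (has_inf_cost mu nu).1.
by move=> _ [P cP <-]; exact: aP.
Qed.

Lemma wasserstein_ge0 mu nu : 0 <= wasserstein mu nu.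
Proof. by apply: le_wasserstein => P _; exact: cost_ge0. Qed.

Lemma wassersteinxx mu : wasserstein mu mu = 0.
Proof.
apply/eqP; rewrite eq_le wasserstein_ge0 andbT.
pose D := pushforward (fun x => (x, x)) mu.
have cD : coupling mu mu D.
  by split; apply: expect_inj => g; rewrite !expect_pushforward.
apply: (le_trans (wasserstein_le cD)).
rewrite /cost expect_pushforward /expect big1// => x _ /=.
by rewrite mdistxx mulr0.
Qed.

Lemma wasserstein_sym_le mu nu : wasserstein mu nu <= wasserstein nu mu.
Proof.
apply: le_wasserstein => P [P1 P2].
pose S := pushforward (fun z => (z.2, z.1)) P.
have cS : coupling mu nu S.
  split; apply: expect_inj => g.
    by rewrite !expect_pushforward -P2 expect_pushforward.
  by rewrite !expect_pushforward -P1 expect_pushforward.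
apply: (le_trans (wasserstein_le cS)).
rewrite /cost expect_pushforward /expect le_eqVlt; apply/orP; left; apply/eqP.
by apply: eq_bigr => z _ /=; rewrite metric_sym.
Qed.

Lemma wasserstein_sym mu nu : wasserstein mu nu = wasserstein nu mu.
Proof. by apply/eqP; rewrite eq_le !wasserstein_sym_le. Qed.

Lemma coupling_fst mu nu P z : coupling mu nu P -> P z <= mu z.1.
Proof.
move=> [<- _]; rewrite -(expect_indic P z) -expect_indic expect_pushforward.
apply: ler_sum => x _; rewrite ler_wpM2l ?fsprob_ge0//= ler_nat.
by case: eqP => [->|//]; rewrite eqxx.
Qed.

Lemma coupling_snd mu nu P z : coupling mu nu P -> P z <= nu z.2.
Proof.
move=> [_ <-]; rewrite -(expect_indic P z) -expect_indic expect_pushforward.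
apply: ler_sum => x _; rewrite ler_wpM2l ?fsprob_ge0//= ler_nat.
by case: eqP => [->|//]; rewrite eqxx.
Qed.

Lemma finite_gap (s : seq (Y * Y)) :
  exists2 d : R, 0 < d & forall z, z \in s -> z.1 != z.2 -> d <= mdist z.1 z.2.
Proof.
elim: s => [|a s [d d0 ds]]; first by exists 1.
have [aa|aa] := eqVneq a.1 a.2.
  exists d => // z; rewrite inE => /predU1P[->|]; first by rewrite aa eqxx.
  exact: ds.
exists (Num.min d (mdist a.1 a.2)); first by rewrite lt_min d0 mdist_gt0.
move=> z; rewrite inE => /predU1P[-> _|zs z12]; rewrite ge_min.
  by rewrite lexx orbT.
by rewrite ds.
Qed.

Lemma wasserstein_eq0_le mu nu y : wasserstein mu nu = 0 -> mu y <= nu y.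
Proof.
move=> W0.
have [d d0 dP] := finite_gap [seq (x, y) | x <- finsupp mu, y <- finsupp nu].
have dle P : coupling mu nu P -> (mu y - nu y) * d <= cost P.
  move=> cP; have [P1 P2] := cP.
  rewrite -(expect_indic mu) -(expect_indic nu) -{1}P1 -{1}P2.
  rewrite !expect_pushforward /expect -sumrB mulr_suml.
  rewrite /cost /expect big_seq [leRHS]big_seq; apply: ler_sum => z zP.
  rewrite -mulrBr -mulrA ler_wpM2l ?fsprob_ge0//=.
  have [z12|z12] := eqVneq z.1 z.2.
    by rewrite z12 subrr mul0r mdist_ge0.
  apply: (@le_trans _ _ d).
    rewrite ler_piMl ?(ltW d0)//.
    by case: eqP => _; case: eqP => _ /=; lra.
  have Pz : 0 < P z.
    by rewrite lt_neqAle fsprob_ge0 andbT eq_sym -mem_finsupp.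
  apply: dP => //; case: z Pz {zP z12} => a b Pz.
  apply/allpairsP; exists (a, b); split => //=; rewrite mem_finsupp gt_eqF//.
    exact: lt_le_trans Pz (coupling_fst (a, b) cP).
  exact: lt_le_trans Pz (coupling_snd (a, b) cP).
have := le_wasserstein dle.
by rewrite W0 pmulr_lle0// subr_le0.
Qed.

Lemma wasserstein_positivity mu nu : wasserstein mu nu = 0 -> mu = nu.
Proof.
move=> W0; apply: fsprobP => y; apply/eqP; rewrite eq_le.
by rewrite !wasserstein_eq0_le// wasserstein_sym.
Qed.

Section Glue.
Context (mu nu rho : fsprob Y) (P Q : fsprob (Y * Y)%type).
Hypotheses (cP : coupling mu nu P) (cQ : coupling nu rho Q).

Let s : seq ((Y * Y) * (Y * Y)) := [seq (a, b) | a <- finsupp P, b <- finsupp Q].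
Let w (c : (Y * Y) * (Y * Y)) : R :=
  (c.2.1 == c.1.2)%:R * (P c.1 * Q c.2 / nu c.1.2).

Let w_ge0 c : c \in s -> 0 <= w c.
Proof. by move=> _; rewrite !mulr_ge0 ?invr_ge0 ?fsprob_ge0. Qed.

Lemma glue_fst g : \sum_(c <- s) w c * g c.1 = expect P g.
Proof.
rewrite /s big_allpairs_dep/= /expect big_seq [RHS]big_seq.
apply: eq_bigr => a aP; rewrite /w/= -mulr_suml; congr (_ * _).
have nu0 : nu a.2 != 0.
  rewrite gt_eqF//; apply: lt_le_trans (coupling_snd a cP).
  by rewrite lt_neqAle fsprob_ge0 andbT eq_sym -mem_finsupp.
rewrite -[RHS](divfK nu0) -[X in _ = _ * X]expect_indic -[X in _ = _ * expect X _]cQ.1.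
rewrite expect_pushforward /expect mulr_sumr.
by apply: eq_bigr => b _ /=; ring.
Qed.

Lemma glue_snd g : \sum_(c <- s) w c * g c.2 = expect Q g.
Proof.
rewrite /s big_allpairs_dep/= exchange_big /expect big_seq [RHS]big_seq/=.
apply: eq_bigr => b bQ; rewrite /w/= -mulr_suml; congr (_ * _).
have nu0 : nu b.1 != 0.
  rewrite gt_eqF//; apply: lt_le_trans (coupling_fst b cQ).
  by rewrite lt_neqAle fsprob_ge0 andbT eq_sym -mem_finsupp.
rewrite -[RHS](divfK nu0) -[X in _ = _ * X]expect_indic -[X in _ = _ * expect X _]cP.2.
rewrite expect_pushforward /expect mulr_sumr.
apply: eq_bigr => a _ /=; rewrite [b.1 == _]eq_sym.
case: eqP => [->|_]; first by ring.
by rewrite !(mul0r, mulr0).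
Qed.

Let w_sum1 : \sum_(c <- s) w c = 1.
Proof.
have := glue_fst (fun=> 1); rewrite /expect.
under eq_bigr do rewrite mulr1.
move=> ->; under eq_bigr do rewrite mulr1.
exact: fsprob_sum1.
Qed.

Definition glue : fsprob (Y * Y)%type :=
  comb (fun c : (Y * Y) * (Y * Y) => (c.1.1, c.2.2)) w_ge0 w_sum1.

Lemma glue_coupling : coupling mu rho glue.
Proof.
split; apply: expect_inj => g; rewrite expect_pushforward expect_comb/=.
  by rewrite (glue_fst (g \o fst)) -cP.1 expect_pushforward.
by rewrite (glue_snd (g \o snd)) -cQ.2 expect_pushforward.
Qed.

Lemma glue_cost : cost glue <= cost P + cost Q.
Proof.
rewrite /cost expect_comb -(glue_fst (fun z => mdist z.1 z.2)).
rewrite -(glue_snd (fun z => mdist z.1 z.2)) -big_split/= big_seq [leRHS]big_seq.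
apply: ler_sum => c cs; rewrite -mulrDr.
rewrite {1 2}/w; case: eqP => [e|_]; last by rewrite !mul0r.
rewrite mul1r ler_wpM2l ?mulr_ge0 ?invr_ge0 ?fsprob_ge0//.
by rewrite e; exact: metric_triangle.
Qed.

End Glue.

Lemma wasserstein_triangle nu mu rho :
  wasserstein mu rho <= wasserstein mu nu + wasserstein nu rho.
Proof.
rewrite -lerBlDr; apply: le_wasserstein => P cP.
rewrite lerBlDr -lerBlDl; apply: le_wasserstein => Q cQ.
rewrite lerBlDl; apply: le_trans (glue_cost cP cQ).
exact/wasserstein_le/glue_coupling.
Qed.

HB.instance Definition _ := isMetric.Build R (fsprob Y)
  wassersteinxx wasserstein_positivity wasserstein_sym wasserstein_triangle.

End Wasserstein.

End FiniteSupport.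

Local Open Scope quotient_scope.

Section Sphere.
Context (R : realType) (n : nat).

Definition dot (u v : 'rV[R]_n.+1) : R := \sum_i u 0 i * v 0 i.

Lemma dotC u v : dot u v = dot v u.
Proof. by apply: eq_bigr => i _; rewrite mulrC. Qed.

Lemma dotDl u v w : dot (u + v) w = dot u w + dot v w.
Proof. by rewrite -big_split; apply: eq_bigr => i _; rewrite mxE mulrDl. Qed.

Lemma dotZl a u v : dot (a *: u) v = a * dot u v.
Proof. by rewrite mulr_sumr; apply: eq_bigr => i _; rewrite mxE mulrA. Qed.

Lemma dotNl u v : dot (- u) v = - dot u v.
Proof. by rewrite -scaleN1r dotZl mulN1r. Qed.

Lemma dotDr u v w : dot u (v + w) = dot u v + dot u w.
Proof. by rewrite !(dotC u) dotDl. Qed.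

Lemma dotZr a u v : dot u (a *: v) = a * dot u v.
Proof. by rewrite !(dotC u) dotZl. Qed.

Lemma dotNr u v : dot u (- v) = - dot u v.
Proof. by rewrite !(dotC u) dotNl. Qed.

Lemma dot0l u : dot 0 u = 0.
Proof. by rewrite -(scale0r 0) dotZl mul0r. Qed.

Lemma dot_ge0 u : 0 <= dot u u.
Proof. by apply: sumr_ge0 => i _; rewrite -expr2 sqr_ge0. Qed.

Lemma dot_eq0 u : (dot u u == 0) = (u == 0).
Proof.
apply/eqP/eqP => [u0|->]; last exact: dot0l.
apply/rowP => i; rewrite mxE; apply/eqP; rewrite -sqrf_eq0 expr2; apply/eqP.
have ge0 (j : 'I_n.+1) : true -> 0 <= u 0 j * u 0 j by rewrite -expr2 sqr_ge0.
by apply: (psumr_eq0P ge0 u0).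
Qed.

Lemma dot_CS u v : dot u v ^+ 2 <= dot u u * dot v v.
Proof.
have [->|v0] := eqVneq v 0; first by rewrite !(dotC _ 0) !dot0l expr0n mulr0.
have vv : 0 < dot v v by rewrite lt_neqAle dot_ge0 eq_sym dot_eq0 v0.
have := dot_ge0 (dot v v *: u - dot u v *: v).
rewrite !(dotDl, dotDr, dotNl, dotNr, dotZl, dotZr) (dotC v u).
set a := dot u u; set b := dot u v; set c := dot v v in vv * => H.
have : 0 <= c * (a * c - b ^+ 2) by move: H; congr (0 <= _); ring.
by rewrite pmulr_rge0// subr_ge0.
Qed.

Record sphere := Sphere { sphere_val :> 'rV[R]_n.+1 ;
                          _ : dot sphere_val sphere_val == 1 }.

HB.instance Definition _ := [isSub for sphere_val].
HB.instance Definition _ := [Choice of sphere by <:].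

Implicit Types x y z : sphere.

Lemma sphere_dot1 x : dot x x = 1.
Proof. by case: x => u /= /eqP. Qed.

Lemma sphere_dot_itv x y : -1 <= dot x y <= 1.
Proof.
rewrite -ler_norml -(@expr_le1 _ 2)// real_normK ?num_real//.
by have := dot_CS x y; rewrite !sphere_dot1 mulr1.
Qed.

(* Rescaled so that great circles have length 1. *)
Definition sphere_dist x y : R := acos (dot x y) / (2 * pi).

Lemma sphere_distxx x : sphere_dist x x = 0.
Proof. by rewrite /sphere_dist sphere_dot1 acos1 mul0r. Qed.

Lemma sphere_dist_positivity x y : sphere_dist x y = 0 -> x = y.
Proof.
move=> /eqP; rewrite mulf_eq0 invr_eq0 mulf_eq0 pnatr_eq0 (gt_eqF (pi_gt0 R)).
rewrite !orbF => /eqP a0.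
have d1 : dot x y = 1.
  by rewrite -[LHS](@acosK R) ?in_itv/= ?sphere_dot_itv// a0 cos0.
apply/val_inj/eqP; rewrite /= -subr_eq0 -dot_eq0.
rewrite dotDl !dotDr !dotNl !dotNr (dotC y x) !sphere_dot1 d1.
by apply/eqP; ring.
Qed.

Lemma sphere_dist_sym x y : sphere_dist x y = sphere_dist y x.
Proof. by rewrite /sphere_dist dotC. Qed.

Lemma acos_dot_triangle y x z :
  acos (dot x z) <= acos (dot x y) + acos (dot y z).
Proof.
have xz := sphere_dot_itv x z; have xy := sphere_dot_itv x y.
have yz := sphere_dot_itv y z.
have [ab|ab] := leP pi (acos (dot x y) + acos (dot y z)).
  exact: le_trans (acos_lepi xz) ab.
rewrite leNgt; apply/negP => lt.
have : cos (acos (dot x z)) < cos (acos (dot x y) + acos (dot y z)).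
  rewrite ltr_cos ?in_itv/= ?acos_ge0 ?acos_lepi//.
  by rewrite addr_ge0 ?acos_ge0//= ltW.
rewrite cosD !acosK ?in_itv/= ?xz ?xy ?yz// !sin_acos//.
apply/negP; rewrite -leNgt.
pose u := (x : 'rV_n.+1) - dot x y *: (y : 'rV_n.+1).
pose v := (z : 'rV_n.+1) - dot y z *: (y : 'rV_n.+1).
have uu : dot u u = 1 - dot x y ^+ 2.
  rewrite !(dotDl, dotDr, dotNl, dotNr, dotZl, dotZr) !sphere_dot1 (dotC y x).
  by ring.
have vv : dot v v = 1 - dot y z ^+ 2.
  rewrite !(dotDl, dotDr, dotNl, dotNr, dotZl, dotZr) !sphere_dot1 (dotC z y).
  by ring.
have uv : dot u v = dot x z - dot x y * dot y z.
  by rewrite !(dotDl, dotDr, dotNl, dotNr, dotZl, dotZr) sphere_dot1; ring.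
rewrite lerBlDl -lerBlDr -uu -vv -sqrtrM ?dot_ge0//.
rewrite -opprB -uv; apply: le_trans (ler_norm _) _.
by rewrite normrN -sqrtr_sqr ler_sqrt ?dot_CS// mulr_ge0 ?dot_ge0.
Qed.

Lemma sphere_dist_triangle y x z :
  sphere_dist x z <= sphere_dist x y + sphere_dist y z.
Proof.
rewrite -mulrDl ler_wpM2r ?acos_dot_triangle//.
by rewrite invr_ge0 mulr_ge0 ?pi_ge0.
Qed.

HB.instance Definition _ := isMetric.Build R sphere
  sphere_distxx sphere_dist_positivity sphere_dist_sym sphere_dist_triangle.

Lemma antipode_subproof x : dot (- (x : 'rV_n.+1)) (- (x : 'rV_n.+1)) == 1.
Proof. by rewrite dotNl dotNr opprK sphere_dot1. Qed.

Definition antipode x : sphere := Sphere (antipode_subproof x).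

Lemma antipodeK : involutive antipode.
Proof. by move=> x; apply/val_inj; rewrite /= opprK. Qed.

Lemma mdist_antipode x y : mdist (antipode x) y = mdist x (antipode y).
Proof. by rewrite /mdist/= /sphere_dist dotNl dotNr. Qed.

Definition antipodal x y := (x == y) || (x == antipode y).

Lemma antipodal_equiv : equiv_class_of antipodal.
Proof.
split=> [x|x y|y x z]; rewrite /antipodal ?eqxx//.
  by rewrite (eq_sym y x) (eq_sym y (antipode x)) (can2_eq antipodeK antipodeK).
move=> /orP[]/eqP-> // /orP[]/eqP->; rewrite ?antipodeK ?eqxx ?orbT//.
Qed.

Canonical antipodal_equiv_rel := EquivRelPack antipodal_equiv.

Definition projective_space := {eq_quot antipodal}.

HB.instance Definition _ := Choice.on projective_space.
HB.instance Definition _ := Quotient.on projective_space.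

Definition proj : sphere -> projective_space := \pi_projective_space.

Implicit Types p : projective_space.

Lemma proj_surj p : exists x, p = proj x.
Proof. by exists (repr p); rewrite /proj reprK. Qed.

Lemma eq_proj x y : proj x = proj y <-> x = y \/ x = antipode y.
Proof.
split=> [/eqquotP/orP[]/eqP|]; [by left|by right|].
by move=> xy; apply/eqquotP/orP; case: xy => ->; [left|right].
Qed.

(* By the next lemma the choice of representatives does not matter. *)
Definition projective_dist p1 p2 : R :=
  Num.min (mdist (repr p1) (repr p2)) (mdist (repr p1) (antipode (repr p2))).

Lemma projective_distE x y :
  projective_dist (proj x) (proj y) = Num.min (mdist x y) (mdist x (antipode y)).
Proof.
rewrite /projective_dist.
have /eq_proj[->|->] : proj (repr (proj x)) = proj x by rewrite /proj reprK.
all: have /eq_proj[->|->] : proj (repr (proj y)) = proj y by rewrite /proj reprK.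
all: by rewrite ?mdist_antipode ?antipodeK// minC.
Qed.

Lemma projective_distxx p : projective_dist p p = 0.
Proof.
have [x ->] := proj_surj p; rewrite projective_distE mdistxx.
by apply/min_idPl; exact: mdist_ge0.
Qed.

Lemma projective_dist_positivity p1 p2 : projective_dist p1 p2 = 0 -> p1 = p2.
Proof.
have [[x ->] [y ->]] := (proj_surj p1, proj_surj p2).
rewrite projective_distE minEle; case: ifP => _ /mdist_positivity xy.
  by rewrite xy.
by apply/eq_proj; right.
Qed.

Lemma projective_dist_sym p1 p2 : projective_dist p1 p2 = projective_dist p2 p1.
Proof.
have [[x ->] [y ->]] := (proj_surj p1, proj_surj p2).
by rewrite !projective_distE metric_sym -mdist_antipode (metric_sym (antipode x)).
Qed.

Lemma projective_dist_triangle p2 p1 p3 :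
  projective_dist p1 p3 <= projective_dist p1 p2 + projective_dist p2 p3.
Proof.
have [[x ->] [y ->]] := (proj_surj p1, proj_surj p2).
have [z ->] := proj_surj p3; rewrite !projective_distE.
have tri a b c := @metric_triangle R sphere a b c.
rewrite [in leRHS]minEle; case: ifP => _; rewrite [in leRHS]minEle; case: ifP => _.
- by rewrite ge_min tri.
- by rewrite ge_min tri orbT.
- have -> : mdist y z = mdist (antipode y) (antipode z).
    by rewrite mdist_antipode antipodeK.
  by rewrite ge_min tri orbT.
- by rewrite ge_min -(mdist_antipode y) tri.
Qed.

HB.instance Definition _ := isMetric.Build R projective_space
  projective_distxx projective_dist_positivity
  projective_dist_sym projective_dist_triangle.

End Sphere.

Section Thickening.
Context (R : realType) (Y : metricType R) (r : R).

(* Point masses belong to VR_lt at every scale, because of x != y. *)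
Definition VR_le : set (fsprob R Y) :=
  [set mu | {in finsupp mu &, forall x y, x != y -> mdist x y <= r}].

Definition VR_lt : set (fsprob R Y) :=
  [set mu | {in finsupp mu &, forall x y, x != y -> mdist x y < r}].

End Thickening.

Arguments VR_le {R} Y r.
Arguments VR_lt {R} Y r.

Section ProjectiveThickening.
Context (R : realType) (n : nat).

Let Sn := sphere R n.
Let RP := projective_space R n.

(* U ranges over the bases of the planes of R^(n+1). *)
Definition great_circle : set (set RP) :=
  [set C | exists2 U : 'M[R]_(2, n.+1), row_free U &
     C = @proj R n @` [set x : Sn | ((x : 'rV[R]_n.+1) <= U)%MS]].

Definition inscribed_equilateral (p0 p1 p2 : RP) : Prop :=
  [/\ exists2 C, great_circle C & [/\ C p0, C p1 & C p2],
      uniq [:: p0; p1; p2] &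
      mdist p0 p1 = mdist p1 p2 /\ mdist p1 p2 = mdist p0 p2].

Definition W : set (fsprob R RP) :=
  [set mu | exists p0 p1 p2,
     inscribed_equilateral p0 p1 p2 /\ finsupp mu = [fset p0; p1; p2]%fset].

Definition barycenter (nu : fsprob R Sn) : 'rV[R]_n.+1 :=
  \sum_(x <- finsupp nu) nu x *: (x : 'rV[R]_n.+1).

Lemma basepoint_subproof :
  dot (delta_mx 0 0 : 'rV[R]_n.+1) (delta_mx 0 0) == 1.
Proof.
apply/eqP; rewrite /dot (bigD1 0)//= big1 => [|i i0]; rewrite !mxE.
  by rewrite !eqxx mulr1 addr0.
by rewrite (negPf i0) mulr0.
Qed.

Definition basepoint : Sn := Sphere basepoint_subproof.

(* The value at 0 is junk. *)
Definition radial (v : 'rV[R]_n.+1) : Sn :=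
  insubd basepoint ((Num.sqrt (dot v v))^-1 *: v).

Lemma radial_val v : v != 0 -> val (radial v) = (Num.sqrt (dot v v))^-1 *: v.
Proof.
move=> v0; rewrite val_insubd dotZl dotZr mulrA -invfM -expr2 sqr_sqrtr ?dot_ge0//.
by rewrite mulVf ?eqxx// dot_eq0.
Qed.

(* A is a thickening of the sphere, B the corresponding thickening of the
   projective space. The value at mu is the common image of the elements of the
   antipodal class in A which corresponds to mu; the default is not reached when
   mu has a lift in A. See pifE. *)
Definition pif (A : set (fsprob R Sn)) (B : set (fsprob R RP)) (mu : B) : RP :=
  xget (proj basepoint)
    [set proj (radial (barycenter nu)) | nu in
       A `&` [set nu | pushforward (@proj R n) nu = \val mu]].

Lemma proj_antipode (x : Sn) : proj (antipode x) = proj x.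
Proof. by apply/eq_proj; right. Qed.

Lemma proj_radialN v : proj (radial (- v)) = proj (radial v).
Proof.
have [->|v0] := eqVneq v 0; first by rewrite oppr0.
rewrite -[RHS]proj_antipode; congr proj; apply: val_inj.
by rewrite /= !radial_val ?oppr_eq0// dotNl dotNr opprK scalerN.
Qed.

Lemma barycenterE nu i : barycenter nu 0 i = expect nu (fun x => val x 0 i).
Proof. by rewrite summxE; apply: eq_bigr => x _; rewrite mxE. Qed.

Lemma barycenter_antipode nu :
  barycenter (pushforward (@antipode R n) nu) = - barycenter nu.
Proof.
apply/rowP => i; rewrite mxE !barycenterE expect_pushforward /expect -sumrN.
by apply: eq_bigr => x _; rewrite /= mxE mulrN.
Qed.

Lemma mdist_antipoder (x y : Sn) : mdist x (antipode y) = 2^-1 - mdist x y.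
Proof.
rewrite /mdist/= /sphere_dist dotNr acosN ?sphere_dot_itv//.
by move: (acos _) => a; move: (pi : R) (pi_gt0 R) => p p0; field; rewrite gt_eqF.
Qed.

Lemma sixth_lt (d : R) : d <= 6^-1 -> 6^-1 < 2^-1 - d.
Proof. by lra. Qed.

Lemma lift_val nu (x0 y : Sn) : VR_le Sn 6^-1 nu -> x0 \in finsupp nu ->
  nu y = if mdist x0 y <= 6^-1 then pushforward (@proj R n) nu (proj y) else 0.
Proof.
move=> nuV x0nu.
have near x : x \in finsupp nu -> mdist x0 x <= 6^-1.
  move=> xnu; have [->|xx0] := eqVneq x0 x; last exact: nuV.
  by rewrite mdistxx invr_ge0.
case: ifPn => [y0|]; last by case: finsuppP => // /near ->.
rewrite -!expect_indic expect_pushforward /expect big_seq [RHS]big_seq.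
apply: eq_bigr => x xnu; congr (_ * (nat_of_bool _)%:R); apply/eqP/eqP => /=.
  by move=> ->.
move=> /eq_proj[//|xy]; have := near _ xnu; rewrite xy mdist_antipoder.
by rewrite leNgt sixth_lt.
Qed.

Lemma lift_uniq nu nu' : VR_le Sn 6^-1 nu -> VR_le Sn 6^-1 nu' ->
  pushforward (@proj R n) nu = pushforward (@proj R n) nu' ->
  nu = nu' \/ nu = pushforward (@antipode R n) nu'.
Proof.
move=> V V' e.
have e' : pushforward (@proj R n) (pushforward (@antipode R n) nu') =
          pushforward (@proj R n) nu'.
  apply: expect_inj => g; rewrite !expect_pushforward; apply: eq_bigr => x _.
  by rewrite /= proj_antipode.
have antiE x : pushforward (@antipode R n) nu' (antipode x) = nu' x.
  rewrite -!expect_indic expect_pushforward; apply: eq_bigr => z _ /=.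
  by rewrite (can_eq (@antipodeK R n)).
have V'' : VR_le Sn 6^-1 (pushforward (@antipode R n) nu').
  move=> x y; rewrite -[x]antipodeK !mem_finsupp antiE mdist_antipode.
  rewrite -{1}[y]antipodeK antiE -!mem_finsupp => xnu ynu xy; apply: V' => //.
  by apply: contraNneq xy => ->; rewrite antipodeK.
have [x0 x0nu] : exists x0, x0 \in finsupp nu.
  have [nu0|[x xnu]] := fset_0Vmem (finsupp nu); last by exists x.
  by have := fsprob_sum1 nu; rewrite nu0 big_seq_fset0 => /esym/eqP; rewrite oner_eq0.
have : pushforward (@proj R n) nu' (proj x0) != 0.
  rewrite -e -[_ (proj x0)](_ : nu x0 = _) -?mem_finsupp//.
  by rewrite (lift_val x0 V x0nu) mdistxx invr_ge0 ler0n.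
rewrite -expect_indic expect_pushforward => e0.
have [x xnu' /esym/eq_proj xx0] : exists2 x, x \in finsupp nu' & proj x = proj x0.
  apply: contrapT => no; case/eqP: e0; rewrite /expect big_seq big1// => x xnu'.
  by rewrite /=; case: eqP => [xx0|]; [case: no; exists x|rewrite mulr0].
case: xx0 => xx0.
  left; apply: fsprobP => y; rewrite (lift_val y V x0nu) e.
  by rewrite -(lift_val y V')// xx0.
right; apply: fsprobP => y; rewrite (lift_val y V x0nu) e -e'.
by rewrite -(lift_val y V'')// xx0 mem_finsupp antiE -mem_finsupp.
Qed.

Lemma pifE (A : set (fsprob R Sn)) (B : set (fsprob R RP)) (mu : B) nu :
  A `<=` VR_le Sn 6^-1 -> A nu -> pushforward (@proj R n) nu = \val mu ->
  pif A mu = proj (radial (barycenter nu)).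
Proof.
move=> AV Anu numu; rewrite /pif; case: xgetP => [p _ [nu' [Anu' /= e] <-]|].
  have [->//|->] := lift_uniq (AV _ Anu') (AV _ Anu) (etrans e (esym numu)).
  by rewrite barycenter_antipode proj_radialN.
by move=> /(_ (proj (radial (barycenter nu)))) []; exists nu.
Qed.

End ProjectiveThickening.

(* Main.v *)
(* The homotopy inverse of [pif] sends [p] to [delta_p], and the straight-line
   homotopy from [delta_(pif mu)] to [mu] stays in the thickening because the
   radial projection of a barycenter is at most as far from a point x of the
   support as some other point of the support is.

   Measures of diameter at most 1/6 on the projective space lift to the sphere
   except those of [W]: if y and z are close to x but not to each other, then
   |y + z - x|^2 <= 0, so x = y + z, and a further point t of the support would
   satisfy |t.y|, |t.z|, |t.y + t.z| >= 1/2, which makes t one of +-x, +-y, +-z.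
   Conversely a lifted equilateral triangle on a great circle would consist of
   dependent unit vectors with common scalar product -1/2.

   Continuity of [pif] uses that |m|^2 - (x.m)^2, for the barycenter m of a lift
   of mu, is the double expectation under mu of a Lipschitz kernel on the
   projective space. *)
Require Import Defs.
From mathcomp Require Import all_boot all_order all_algebra generic_quotient finmap.
From mathcomp Require Import all_classical all_reals all_analysis.
From mathcomp Require Import ring lra.

Set Implicit Arguments.
Unset Strict Implicit.
Unset Printing Implicit Defensive.

Import Order.TTheory GRing.Theory Num.Theory.
Import numFieldNormedType.Exports.

Local Open Scope classical_set_scope.
Local Open Scope ring_scope.

Local Notation pushforward := Defs.pushforward.
Local Notation proj := Defs.proj.

(** * Expectations under finitely supported measures *)

Section Expectation.
Context (R : realType) (T : choiceType).
Implicit Types (mu nu : fsprob R T) (f g : T -> R).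

Lemma eq_expect mu f g : {in finsupp mu, f =1 g} -> expect mu f = expect mu g.
Proof.
by move=> fg; rewrite /expect big_seq [RHS]big_seq; apply: eq_bigr => x /fg ->.
Qed.

Lemma expect_cst mu a : expect mu (fun=> a) = a.
Proof. by rewrite /expect -mulr_suml fsprob_sum1 mul1r. Qed.

Lemma expectB mu f g : expect mu (fun x => f x - g x) = expect mu f - expect mu g.
Proof. by rewrite /expect -sumrB; apply: eq_bigr => x _; rewrite mulrBr. Qed.

Lemma expectZ mu a f : expect mu (fun x => a * f x) = a * expect mu f.
Proof. by rewrite /expect mulr_sumr; apply: eq_bigr => x _; rewrite mulrCA. Qed.

Lemma le_expect mu f g : {in finsupp mu, forall x, f x <= g x} ->
  expect mu f <= expect mu g.
Proof.
move=> fg; rewrite /expect big_seq [leRHS]big_seq; apply: ler_sum => x /fg fgx.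
by rewrite ler_wpM2l ?fsprob_ge0.
Qed.

Lemma le_expect_norm mu f : `|expect mu f| <= expect mu (fun x => `|f x|).
Proof.
apply: le_trans (ler_norm_sum _ _ _) _; apply: ler_sum => x _.
by rewrite normrM (ger0_norm (fsprob_ge0 _ _)).
Qed.

(** Otherwise [f] minus its mean would be positive on the nonempty support, although its expectation
    is 0. *)
Lemma exists_le_expect mu f : exists2 x, x \in finsupp mu & f x <= expect mu f.
Proof.
apply: contrapT => no.
have pos x : x \in finsupp mu -> 0 < mu x * (f x - expect mu f).
  move=> xmu; rewrite mulr_gt0//.
    by rewrite lt_neqAle fsprob_ge0 andbT eq_sym -mem_finsupp.
  by rewrite subr_gt0 ltNge; apply/negP => le; apply: no; exists x.
have : 0 < expect mu (fun x => f x - expect mu f).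
  rewrite /expect big_seq; have [mu0|[x xmu]] := fset_0Vmem (finsupp mu).
    by have := fsprob_sum1 mu; rewrite mu0 big_seq_fset0 => /eqP; rewrite eq_sym oner_eq0.
  rewrite (big_rem x)//= xmu ltr_wpDr ?pos// sumr_ge0// => y /pos; exact: ltW.
by rewrite expectB expect_cst subrr ltxx.
Qed.

Lemma finsupp_expect mu y : (y \in finsupp mu) = (expect mu (fun x => (x == y)%:R) != 0).
Proof. by rewrite expect_indic mem_finsupp. Qed.

End Expectation.

(** Weights are nonnegative, so the masses of points with the same image cannot cancel. *)
Lemma finsupp_pushforward (R : realType) (T U : choiceType) (q : T -> U)
    (mu : fsprob R T) u :
  reflect (exists2 x, x \in finsupp mu & q x = u) (u \in finsupp (pushforward q mu)).
Proof.
rewrite finsupp_expect expect_pushforward; apply: (iffP idP) => [|[x xmu <-]].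
  apply: contraNP => no; rewrite -(expect_cst mu 0); apply/eqP/eq_expect => x xmu /=.
  by case: eqP => // qx; case: no; exists x.
rewrite gt_eqF//; apply: (@lt_le_trans _ _ (mu x)).
  by rewrite lt_neqAle fsprob_ge0 andbT eq_sym -mem_finsupp.
rewrite -expect_indic; apply: le_expect => z _ /=; rewrite ler_nat.
by case: eqP => [->|//]; rewrite eqxx.
Qed.

(** * Segments from a point mass to a measure *)

Section Cone.
Context (R : realType) (T : choiceType).
Implicit Types (mu : fsprob R T) (t : R).

(** Clamping makes [cone] a probability measure for every real parameter, so that the homotopy is
    continuous on the whole line of times and not only over [0, 1]. *)
Definition clamp t : R := if t <= 0 then 0 else if 1 <= t then 1 else t.

Lemma clamp_ge0 t : 0 <= clamp t.
Proof. by rewrite /clamp; case: (lerP t 0) => // /ltW t0; case: ifP. Qed.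

Lemma clamp_le1 t : clamp t <= 1.
Proof. by rewrite /clamp; case: ifP => // _; case: (lerP 1 t) => // /ltW. Qed.

Lemma clamp_id t : 0 <= t <= 1 -> clamp t = t.
Proof.
case/andP => t0 t1; rewrite /clamp.
by case: (lerP t 0) => ?; [lra|case: (lerP 1 t) => ?; lra].
Qed.

Lemma clamp_lipschitz s t : `|clamp s - clamp t| <= `|s - t|.
Proof.
have st := ler_norm (s - t); have ts := ler_norm (t - s); rewrite distrC in ts.
rewrite ler_norml /clamp.
case: (lerP s 0) => ?; case: (lerP t 0) => ?; case: (lerP 1 s) => ?;
  case: (lerP 1 t) => ?; apply/andP; split; lra.
Qed.

Section Def.
Context (t : R) (mu : fsprob R T) (p : T).

(** The support is doubled: the copy marked [true] stays in place, the copy marked [false] collapses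
    to [p]. *)
Let s := [seq (b, y) | b <- [:: true; false], y <- finsupp mu].
Let w (z : bool * T) : R := (if z.1 then clamp t else 1 - clamp t) * mu z.2.

Let w_ge0 z : z \in s -> 0 <= w z.
Proof.
by move=> _; rewrite mulr_ge0 ?fsprob_ge0//; case: z.1; rewrite ?subr_ge0 ?clamp_ge0 ?clamp_le1.
Qed.

Let sum_w (g : T -> R) :
  \sum_(z <- s) w z * g (if z.1 then z.2 else p) =
  clamp t * expect mu g + (1 - clamp t) * g p.
Proof.
rewrite /s big_allpairs_dep/= !big_cons big_nil addr0 /w/=; congr (_ + _).
  by rewrite /expect mulr_sumr; apply: eq_bigr => y _; rewrite mulrA.
by rewrite -mulr_suml -mulr_sumr fsprob_sum1 mulr1.
Qed.

Let w_sum1 : \sum_(z <- s) w z = 1.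
Proof.
have := sum_w (fun=> 1); under eq_bigr do rewrite mulr1.
by move=> ->; rewrite expect_cst !mulr1 addrC subrK.
Qed.

(* The measure t mu + (1 - t) delta_p, with t clamped to [0, 1]. *)
Definition cone : fsprob R T :=
  comb (fun z : bool * T => if z.1 then z.2 else p) w_ge0 w_sum1.

Lemma expect_cone g : expect cone g = clamp t * expect mu g + (1 - clamp t) * g p.
Proof. by rewrite expect_comb sum_w. Qed.

Lemma finsupp_cone y : y \in finsupp cone -> y = p \/ y \in finsupp mu.
Proof.
rewrite finsupp_expect expect_cone expect_indic => H.
have [->|/eqP py] := eqVneq p y; [by left|right].
rewrite mem_finsupp; apply: contra_neq H => ->.
by case: eqP => // _; rewrite !mulr0 addr0.
Qed.

End Def.

Lemma cone1 mu p : cone 1 mu p = mu.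
Proof.
apply: expect_inj => g.
by rewrite expect_cone clamp_id ?lexx ?ler01// subrr mul0r addr0 mul1r.
Qed.

End Cone.

Lemma pushforward_cone (R : realType) (T U : choiceType) (q : T -> U) (t : R)
    (mu : fsprob R T) p :
  pushforward q (cone t mu p) = cone t (pushforward q mu) (q p).
Proof.
by apply: expect_inj => g; rewrite expect_pushforward !expect_cone expect_pushforward.
Qed.

Section Dirac.
Context (R : realType) (T : choiceType).

Lemma dirac_ge0 (x y : T) : y \in [:: x] -> 0 <= 1 :> R.
Proof. by rewrite ler01. Qed.

Lemma dirac_sum1 (x : T) : \sum_(y <- [:: x]) 1 = 1 :> R.
Proof. by rewrite big_seq1. Qed.

Definition dirac_fsprob (x : T) : fsprob R T := comb id (@dirac_ge0 x) (dirac_sum1 x).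

Lemma expect_dirac x g : expect (dirac_fsprob x) g = g x.
Proof. by rewrite expect_comb big_seq1 mul1r. Qed.

Lemma finsupp_dirac x y : (y \in finsupp (dirac_fsprob x)) = (y == x).
Proof. by rewrite finsupp_expect expect_dirac pnatr_eq0 eqb0 negbK eq_sym. Qed.

Lemma cone0 mu x : cone 0 mu x = dirac_fsprob x.
Proof.
apply: expect_inj => g.
by rewrite expect_cone expect_dirac clamp_id ?lexx ?ler01// mul0r add0r subr0 mul1r.
Qed.

End Dirac.

Lemma pushforward_dirac (R : realType) (T U : choiceType) (q : T -> U) (x : T) :
  pushforward q (dirac_fsprob R x) = dirac_fsprob R (q x).
Proof. by apply: expect_inj => g; rewrite expect_pushforward !expect_dirac. Qed.

(** * Estimates for the Wasserstein distance *)

Section WassersteinBounds.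
Context (R : realType) (Y : metricType R).
Implicit Types (mu nu : fsprob R Y) (t : R).

(** The easy half of Kantorovich duality: the Lipschitz bound is integrated against an arbitrary
    coupling. *)
Lemma expect_lipschitz mu nu (g : Y -> R) L : 0 < L ->
  (forall p q, `|g p - g q| <= L * mdist p q) ->
  `|expect mu g - expect nu g| <= L * wasserstein mu nu.
Proof.
move=> L0 gL; rewrite -ler_pdivrMl//; apply: le_wasserstein => P [<- <-].
rewrite ler_pdivrMl// !expect_pushforward -expectB.
apply: le_trans (le_expect_norm _ _) _; rewrite /cost -expectZ.
by apply: le_expect => z _; exact: gL.
Qed.

(** The two copies of the measure are exchanged one after the other; by symmetry, averaging [k] in
    one variable leaves an [L]-Lipschitz function of the other. *)
Lemma expect2_lipschitz mu nu (k : Y -> Y -> R) L : 0 < L ->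
  (forall p q, k p q = k q p) ->
  (forall p q q', `|k p q - k p q'| <= L * mdist q q') ->
  `|expect mu (fun p => expect mu (k p)) - expect nu (fun p => expect nu (k p))|
    <= 2 * L * wasserstein mu nu.
Proof.
move=> L0 kC kL.
have -> : expect mu (fun p => expect mu (k p)) - expect nu (fun p => expect nu (k p)) =
    (expect mu (fun p => expect mu (k p)) - expect nu (fun p => expect mu (k p))) +
    expect nu (fun p => expect mu (k p) - expect nu (k p)).
  by rewrite expectB; ring.
apply: le_trans (ler_normD _ _) _.
have -> : 2 * L * wasserstein mu nu = L * wasserstein mu nu + L * wasserstein mu nu.
  by ring.
apply: lerD.
  apply: expect_lipschitz => // p q; rewrite -expectB.
  apply: le_trans (le_expect_norm _ _) _; rewrite -[leRHS](expect_cst mu).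
  by apply: le_expect => z _; rewrite !(kC _ z).
apply: le_trans (le_expect_norm _ _) _; rewrite -[leRHS](expect_cst nu).
by apply: le_expect => z _; exact: expect_lipschitz.
Qed.

Lemma wasserstein_comb_le (I : choiceType) (s : seq I) w (h1 h2 : I -> Y)
    (w_ge0 : forall i, i \in s -> 0 <= w i) (w_sum1 : \sum_(i <- s) w i = 1) :
  wasserstein (comb h1 w_ge0 w_sum1) (comb h2 w_ge0 w_sum1) <=
  \sum_(i <- s) w i * mdist (h1 i) (h2 i).
Proof.
pose P := comb (fun i => (h1 i, h2 i)) w_ge0 w_sum1.
have cP : coupling (comb h1 w_ge0 w_sum1) (comb h2 w_ge0 w_sum1) P.
  by split; apply: expect_inj => g; rewrite expect_pushforward !expect_comb.
by apply: le_trans (wasserstein_le cP) _; rewrite /cost expect_comb.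
Qed.

Lemma wasserstein_dirac (x y : Y) :
  wasserstein (dirac_fsprob R x) (dirac_fsprob R y) <= mdist x y.
Proof.
have cP : coupling (dirac_fsprob R x) (dirac_fsprob R y) (dirac_fsprob R (x, y)).
  by split; apply: expect_inj => g; rewrite expect_pushforward !expect_dirac.
by apply: le_trans (wasserstein_le cP) _; rewrite /cost expect_dirac.
Qed.

(** The cone over a coupling, with apex [(p, q)], couples the two cones. *)
Lemma wasserstein_cone t mu nu (p q : Y) :
  wasserstein (cone t mu p) (cone t nu q) <= wasserstein mu nu + mdist p q.
Proof.
rewrite -lerBlDr; apply: le_wasserstein => P [<- <-]; rewrite lerBlDr.
have cP : coupling (cone t (pushforward fst P) p) (cone t (pushforward snd P) q)
    (cone t P (p, q)) by split; rewrite pushforward_cone.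
apply: le_trans (wasserstein_le cP) _; rewrite /cost expect_cone/=.
apply: lerD; first by rewrite ler_piMl ?clamp_le1 ?cost_ge0.
by rewrite ler_piMl ?mdist_ge0// gerBl clamp_ge0.
Qed.

(* Only the mass |t - t'| has to move. *)
Lemma wasserstein_cone_time t t' mu (p : Y) D : (forall x y : Y, mdist x y <= D) ->
  wasserstein (cone t mu p) (cone t' mu p) <= `|t - t'| * D.
Proof.
move=> leD; have D0 : 0 <= D := le_trans (mdist_ge0 p p) (leD p p).
apply: (@le_trans _ _ (`|clamp t - clamp t'| * D)); last first.
  by rewrite ler_wpM2r ?clamp_lipschitz.
wlog tt' : t t' / clamp t <= clamp t' => [th|].
  have [?|/ltW?] := leP (clamp t) (clamp t'); first exact: th.
  by rewrite wasserstein_sym distrC; exact: th.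
rewrite distrC ger0_norm ?subr_ge0//.
(* Three copies of the support: the first stays in place for both parameters, the second stays only
   for the larger one, the third collapses to [p] for both. *)
pose s := [seq (b, y) | b <- [:: Some true; Some false; None], y <- finsupp mu].
pose w (z : option bool * Y) : R := (match z.1 with
  Some true => clamp t | Some false => clamp t' - clamp t | None => 1 - clamp t' end)
  * mu z.2.
have w_ge0 z : z \in s -> 0 <= w z.
  rewrite /w mulr_ge0 ?fsprob_ge0//.
  by case: z.1 => [[]|]; rewrite ?subr_ge0 ?clamp_ge0 ?clamp_le1.
have sum_w (g1 g2 g3 : Y -> R) : \sum_(z <- s) w z * (match z.1 with
    Some true => g1 z.2 | Some false => g2 z.2 | None => g3 z.2 end) =
  clamp t * expect mu g1 + (clamp t' - clamp t) * expect mu g2 +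
    (1 - clamp t') * expect mu g3.
  rewrite /s big_allpairs_dep/= !big_cons big_nil addr0 addrA /w/= /expect !mulr_sumr.
  by congr (_ + _ + _); apply: eq_bigr => y _; rewrite mulrA.
have w_sum1 : \sum_(z <- s) w z = 1.
  have := sum_w (fun=> 1) (fun=> 1) (fun=> 1); rewrite !expect_cst => e.
  transitivity (\sum_(z <- s) w z * 1); first by apply: eq_bigr => z _; rewrite mulr1.
  rewrite [RHS](_ : 1 = clamp t * 1 + (clamp t' - clamp t) * 1 + (1 - clamp t') * 1); last by ring.
  by rewrite -e; apply: eq_bigr => -[[[]|] y].
pose h1 (z : option bool * Y) := if z.1 is Some true then z.2 else p.
pose h2 (z : option bool * Y) := if z.1 is Some _ then z.2 else p.
have -> : cone t mu p = comb h1 w_ge0 w_sum1.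
  apply: expect_inj => g; rewrite expect_cone expect_comb.
  transitivity (clamp t * expect mu g + (clamp t' - clamp t) * expect mu (fun=> g p) +
    (1 - clamp t') * expect mu (fun=> g p)); first by rewrite !expect_cst; ring.
  by rewrite -sum_w; apply: eq_bigr => -[[[]|] y].
have -> : cone t' mu p = comb h2 w_ge0 w_sum1.
  apply: expect_inj => g; rewrite expect_cone expect_comb.
  transitivity (clamp t * expect mu g + (clamp t' - clamp t) * expect mu g +
    (1 - clamp t') * expect mu (fun=> g p)); first by rewrite !expect_cst; ring.
  by rewrite -sum_w; apply: eq_bigr => -[[[]|] y].
apply: le_trans (wasserstein_comb_le _ _ _ _) _.
apply: (@le_trans _ _ (\sum_(z <- s) w z * (match z.1 with
    Some true => 0 | Some false => D | None => 0 end))).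
  rewrite big_seq [leRHS]big_seq; apply: ler_sum => -[[[]|] y] /w_ge0 w0;
    by rewrite ler_wpM2l ?w0// /h1 /h2 /= ?mdistxx.
rewrite (sum_w (fun=> 0) (fun=> D) (fun=> 0)) !expect_cst !mulr0 add0r addr0//.
Qed.

End WassersteinBounds.

(** * Distances and scalar products on the sphere and the projective space *)

Section SphereGeometry.
Context (R : realType) (n : nat).
Implicit Types (x y z : sphere R n) (u v : 'rV[R]_n.+1) (p q : projective_space R n).

Lemma mdistE x y : 2 * pi * mdist x y = acos (dot x y).
Proof.
rewrite /mdist/= /sphere_dist; move: (acos _) => a.
by move: (pi : R) (pi_gt0 R) => c c0; field; rewrite gt_eqF.
Qed.

Lemma cos_mdist x y : cos (2 * pi * mdist x y) = dot x y.
Proof. by rewrite mdistE acosK// in_itv/= sphere_dot_itv. Qed.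

Lemma mdist_le_half x y : mdist x y <= 2^-1.
Proof.
have : 2 * pi * mdist x y <= 2 * pi * 2^-1.
  by rewrite mdistE mulrAC divff// mul1r acos_lepi ?sphere_dot_itv.
by rewrite ler_pM2l// mulr_gt0 ?pi_gt0.
Qed.

Lemma mdist_leE x y d : 0 <= d <= 2^-1 ->
  (mdist x y <= d) = (cos (2 * pi * d) <= dot x y).
Proof.
have itv c : 0 <= c <= 2^-1 -> 2 * pi * c \in `[0, (pi : R)].
  case/andP => c0 c1; rewrite in_itv/= !mulr_ge0 ?pi_ge0//=.
  rewrite [leRHS](_ : _ = 2 * pi * 2^-1); last by rewrite mulrAC divff// mul1r.
  by rewrite ler_wpM2l// mulr_ge0 ?pi_ge0.
move=> dI; rewrite -cos_mdist !leNgt ltr_cos ?itv// ?mdist_ge0 ?mdist_le_half//.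
by rewrite ltr_pM2l// mulr_gt0 ?pi_gt0.
Qed.

Lemma mdist_le_dot x y z w : (mdist x y <= mdist z w) = (dot z w <= dot x y).
Proof. by rewrite mdist_leE ?mdist_ge0 ?mdist_le_half// cos_mdist. Qed.

(** For [a = pi/3] the angle [2 a] equals [pi - a], so [cos a] is a root of [2 c^2 + c - 1]; it is
    the positive one. *)
Lemma cos_sixth : cos (2 * pi * 6^-1) = 2^-1 :> R.
Proof.
have pi0 := pi_gt0 R; set a := 2 * pi * 6^-1.
have a0 : 0 < cos a by apply: cos_gt0_pihalf; rewrite /a; apply/andP; split; lra.
have s0 : sin a != 0.
  by rewrite gt_eqF// sin_gt0_pi// /a; apply/andP; split; lra.
have e : cos (a *+ 2) = - cos a.
  by rewrite -(cosN a) -cosDpi; congr cos; rewrite /a; field.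
have : (cos a + 1) * (cos a - 2^-1) = 0.
  by move: e; rewrite cos_mulr2n -mulr_natr expr2; move: (cos a) => c e; lra.
by move=> /eqP; rewrite mulf_eq0 => /orP[] /eqP; lra.
Qed.

Lemma mdist_le_sixth x y : (mdist x y <= 6^-1) = (2^-1 <= dot x y).
Proof. by rewrite mdist_leE ?cos_sixth//; apply/andP; split; lra. Qed.

Lemma mdist_proj x y : mdist (proj x) (proj y) = Num.min (mdist x y) (mdist x (antipode y)).
Proof. exact: projective_distE. Qed.

Lemma mdist_proj_le x y : mdist (proj x) (proj y) <= mdist x y.
Proof. by rewrite mdist_proj ge_min lexx. Qed.

Lemma mdist_proj_near x y : mdist x y <= 6^-1 -> mdist (proj x) (proj y) = mdist x y.
Proof.
move=> xy; rewrite mdist_proj; apply/min_idPl; rewrite mdist_antipoder.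
by have := sixth_lt xy; lra.
Qed.

Lemma mdist_proj_le_half p q : mdist p q <= 2^-1.
Proof.
have [[x ->] [y ->]] := (proj_surj p, proj_surj q).
exact: le_trans (mdist_proj_le x y) (mdist_le_half x y).
Qed.

Lemma mdist_proj_le_sixth x y :
  (mdist (proj x) (proj y) <= 6^-1) = (2^-1 <= `|dot x y|).
Proof. by rewrite mdist_proj ge_min !mdist_le_sixth dotNr ler_normr. Qed.

Lemma sphere_dot_norm x y : `|dot x y| <= 1.
Proof. by rewrite ler_norml sphere_dot_itv. Qed.

Lemma sphere_dot_eq1 x y : 1 <= dot x y -> x = y.
Proof.
move=> xy; have := dot_ge0 (val x - val y).
have e : dot (val x - val y) (val x - val y) = 2 - 2 * dot x y.
  by rewrite dotDl !dotDr !dotNl !dotNr (dotC y x) !sphere_dot1; ring.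
rewrite e => ge0; apply/val_inj/eqP; rewrite -subr_eq0 -dot_eq0 e.
by apply/eqP; lra.
Qed.

Lemma proj_dot_eq1 x y : 1 <= `|dot x y| -> proj x = proj y.
Proof.
rewrite ler_normr => /orP[/sphere_dot_eq1 -> //|]; rewrite -dotNr => xy.
by rewrite (@sphere_dot_eq1 x (antipode y))// proj_antipode.
Qed.

Lemma abs_sin_le (a : R) : 0 <= a -> `|sin a| <= a.
Proof.
move=> a0.
have [c _] : exists2 c, c \in `[0, a] & sin a - sin 0 = cos c * (a - 0).
  by apply: MVT_segment => //; apply: continuous_subspaceT; exact: continuous_sin.
rewrite sin0 !subr0 => ->; rewrite normrM (ger0_norm a0).
by rewrite ler_piMl// ler_norml cos_geN1 cos_le1.
Qed.

(** By Cauchy-Schwarz the difference is at most the chord from [y] to [z], and the chord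
    [2 sin (t/2)] is at most the arc [t = 2 pi mdist y z]. *)
Lemma dot_lipschitz x y z : `|dot x y - dot x z| <= 2 * pi * mdist y z.
Proof.
have t0 : 0 <= 2 * pi * mdist y z by rewrite mulr_ge0 ?mdist_ge0// mulr_ge0 ?pi_ge0.
rewrite -ler_sqr ?nnegrE// real_normK ?num_real//.
have -> : dot x y - dot x z = dot x (val y - val z) by rewrite dotDr dotNr.
apply: le_trans (dot_CS _ _) _; rewrite sphere_dot1 mul1r.
have -> : dot (val y - val z) (val y - val z) = 2 - 2 * dot y z.
  by rewrite dotDl !dotDr !dotNl !dotNr (dotC z y) !sphere_dot1; ring.
rewrite -cos_mdist; set t := 2 * pi * mdist y z in t0 *.
have [h tE] : exists h, t = h *+ 2 by exists (t / 2); rewrite -mulr_natr divfK.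
have h0 : 0 <= h by move: t0; rewrite tE pmulrn_lge0.
have := abs_sin_le h0; rewrite -ler_sqr ?nnegrE// real_normK ?num_real// sin2cos2.
rewrite tE cos_mulr2n -(mulr_natl (_ ^+ 2)) -(mulr_natl h) exprMn.
by move: (cos h ^+ 2) (h ^+ 2) => c d; lra.
Qed.

End SphereGeometry.

(** * Barycenters, radial projection, and stability of the thickenings under cones *)

Section Barycenter.
Context (R : realType) (n : nat).
Implicit Types (x y z : sphere R n) (nu : fsprob R (sphere R n)).

Lemma dot_barycenter (u : 'rV[R]_n.+1) nu : dot u (barycenter nu) = expect nu (fun y => dot u y).
Proof.
rewrite /dot; under eq_bigr do rewrite barycenterE -expectZ.
by rewrite /expect exchange_big/=; apply: eq_bigr => y _; rewrite mulr_sumr.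
Qed.

Lemma VR_le_dot nu : VR_le (sphere R n) 6^-1 nu ->
  {in finsupp nu &, forall x y, 2^-1 <= dot x y}.
Proof.
move=> V x y xnu ynu; have [->|xy] := eqVneq x y.
  by rewrite sphere_dot1 invf_le1 ?ler1n.
by rewrite -mdist_le_sixth; exact: V.
Qed.

Lemma barycenter_dot_ge nu x : VR_le (sphere R n) 6^-1 nu -> x \in finsupp nu ->
  2^-1 <= dot x (barycenter nu).
Proof.
move=> V xnu; rewrite dot_barycenter -(expect_cst nu 2^-1).
by apply: le_expect => y ynu; exact: (VR_le_dot V).
Qed.

(** Besides keeping barycenters off the origin, this uniform bound absorbs a division by the squared
    norm in the continuity estimate. *)
Lemma barycenter_norm_ge nu : VR_le (sphere R n) 6^-1 nu ->
  2^-1 <= dot (barycenter nu) (barycenter nu).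
Proof.
move=> V; rewrite {2}/barycenter.
rewrite dot_barycenter -(expect_cst nu 2^-1).
by apply: le_expect => y ynu; rewrite dotC; exact: barycenter_dot_ge.
Qed.

Lemma barycenter_norm_le nu : dot (barycenter nu) (barycenter nu) <= 1.
Proof.
rewrite dot_barycenter -(expect_cst nu 1); apply: le_expect => y _.
rewrite dotC dot_barycenter -(expect_cst nu 1); apply: le_expect => z _.
by have /andP[] := sphere_dot_itv y z.
Qed.

Lemma barycenter_neq0 nu : VR_le (sphere R n) 6^-1 nu -> barycenter nu != 0.
Proof.
by move=> /barycenter_norm_ge; rewrite -dot_eq0; apply: contraTneq => ->; rewrite -ltNge; lra.
Qed.

Lemma dot_radial nu (u : 'rV[R]_n.+1) : VR_le (sphere R n) 6^-1 nu ->
  dot (radial (barycenter nu)) u = dot (barycenter nu) u / Num.sqrt (dot (barycenter nu) (barycenter nu)).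
Proof. by move=> V; rewrite (radial_val (barycenter_neq0 V)) dotZl mulrC. Qed.

(* Passing from the mean of the [y] to its radial projection increases a
   nonnegative scalar product with [x], and some [y] has at most the mean. *)
Lemma radial_mdist_le nu x : VR_le (sphere R n) 6^-1 nu -> x \in finsupp nu ->
  exists2 y, y \in finsupp nu & mdist (radial (barycenter nu)) x <= mdist y x.
Proof.
move=> V xnu; have [y ynu le] := exists_le_expect nu (fun y => dot x y).
exists y => //; rewrite mdist_le_dot dotC; apply: (le_trans le).
rewrite -dot_barycenter (dot_radial _ V) (dotC _ x).
have m0 := barycenter_norm_ge V.
rewrite ler_pdivlMr ?sqrtr_gt0; last by lra.
rewrite ler_piMr//; first by have := barycenter_dot_ge V xnu; lra.
by rewrite -[leRHS]sqrtr1 ler_sqrt ?ler01 ?barycenter_norm_le.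
Qed.

Section ConeClosed.
Variables (nu : fsprob R (sphere R n)) (r t : R).
Hypothesis r6 : r <= 6^-1.

(** Only distances to the apex are new, and [radial_mdist_le] dominates them by distances within the
    support. *)
Lemma VR_le_cone : VR_le (sphere R n) r nu ->
  VR_le (sphere R n) r (cone t nu (radial (barycenter nu))).
Proof.
move=> V; have V6 : VR_le (sphere R n) 6^-1 nu.
  by move=> x y xnu ynu xy; exact: le_trans (V _ _ _ _ _) r6.
have near x : x \in finsupp nu -> radial (barycenter nu) != x ->
    mdist (radial (barycenter nu)) x <= r.
  move=> xnu xr; have [y ynu le] := radial_mdist_le V6 xnu.
  (* [V] bounds distances of distinct points only; if [y] is [x], the apex is [x] as well. *)
  have [yx|yx] := eqVneq y x; last exact: le_trans le (V _ _ ynu xnu yx).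
  by move: le; rewrite yx mdistxx leNgt mdist_gt0 xr.
move=> x y /finsupp_cone[->|xnu] /finsupp_cone[->|ynu] xy; first by rewrite eqxx in xy.
- exact: near.
- by rewrite metric_sym near// eq_sym.
- exact: V.
Qed.

(** The comparison is with a distance between two support points, so the strict inequality
    survives. *)
Lemma VR_lt_cone : VR_lt (sphere R n) r nu ->
  VR_lt (sphere R n) r (cone t nu (radial (barycenter nu))).
Proof.
move=> V; have V6 : VR_le (sphere R n) 6^-1 nu.
  by move=> x y xnu ynu xy; exact: le_trans (ltW (V _ _ _ _ _)) r6.
have near x : x \in finsupp nu -> radial (barycenter nu) != x ->
    mdist (radial (barycenter nu)) x < r.
  move=> xnu xr; have [y ynu le] := radial_mdist_le V6 xnu.
  have [yx|yx] := eqVneq y x; last exact: le_lt_trans le (V _ _ ynu xnu yx).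
  by move: le; rewrite yx mdistxx leNgt mdist_gt0 xr.
move=> x y /finsupp_cone[->|xnu] /finsupp_cone[->|ynu] xy; first by rewrite eqxx in xy.
- exact: near.
- by rewrite metric_sym near// eq_sym.
- exact: V.
Qed.

End ConeClosed.

End Barycenter.

(** * Lifting measures from the projective space, and the obstruction [W] *)

Lemma in_fset3 (K : choiceType) (a b c p : K) :
  (p \in [fset a; b; c]%fset) = [|| p == a, p == b | p == c].
Proof. by rewrite !inE orbA. Qed.

Lemma uniq3 (K : eqType) (a b c : K) :
  uniq [:: a; b; c] = [&& a != b, a != c & b != c].
Proof. by rewrite /= !inE negb_or andbT andbA. Qed.

Lemma eq_fset3 (K : choiceType) (A : {fset K}) (a b c : K) :
  [/\ a \in A, b \in A & c \in A] ->
  (forall p, p \in A -> [\/ p = a, p = b | p = c]) -> A = [fset a; b; c]%fset.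
Proof.
move=> [aA bA cA] sub; apply/fsetP => p; rewrite in_fset3; apply/idP/or3P.
  by case/sub => ->; [apply: Or31|apply: Or32|apply: Or33].
by case=> /eqP ->.
Qed.

Section Lifting.
Context (R : realType) (n : nat).
Let Sn := sphere R n.
Let RP := projective_space R n.
Implicit Types (x y z : Sn) (nu : fsprob R Sn) (mu : fsprob R RP).

Lemma pushforward_VR_le nu r : VR_le Sn r nu -> VR_le RP r (pushforward (@proj R n) nu).
Proof.
move=> V _ _ /finsupp_pushforward[x xnu <-] /finsupp_pushforward[y ynu <-] xy.
by apply: le_trans (mdist_proj_le x y) (V _ _ xnu ynu _); apply: contra_neq xy => ->.
Qed.

Lemma pushforward_VR_lt nu r : VR_lt Sn r nu -> VR_lt RP r (pushforward (@proj R n) nu).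
Proof.
move=> V _ _ /finsupp_pushforward[x xnu <-] /finsupp_pushforward[y ynu <-] xy.
by apply: le_lt_trans (mdist_proj_le x y) (V _ _ xnu ynu _); apply: contra_neq xy => ->.
Qed.

Lemma mdist_lift nu : VR_le Sn 6^-1 nu ->
  {in finsupp nu &, forall x y, mdist x y = mdist (proj x) (proj y)}.
Proof.
move=> V x y xnu ynu; rewrite mdist_proj_near//.
by have [->|xy] := eqVneq x y; [rewrite mdistxx invr_ge0|exact: V].
Qed.

Lemma proj_lift_neq nu : VR_le Sn 6^-1 nu ->
  {in finsupp nu &, forall x y, x != y -> proj x != proj y}.
Proof.
move=> V x y xnu ynu; apply: contra_neq => xy; apply: mdist_positivity.
by rewrite (mdist_lift V)// xy mdistxx.
Qed.

(** The projection is isometric on the support of a lift of diameter at most 1/6, so such a lift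
    inherits the scale of its image. *)
Lemma lift_VR_le nu r : VR_le Sn 6^-1 nu -> VR_le RP r (pushforward (@proj R n) nu) ->
  VR_le Sn r nu.
Proof.
move=> V Vr x y xnu ynu xy; rewrite (mdist_lift V)//.
apply: Vr; [apply/finsupp_pushforward; by exists x|
  apply/finsupp_pushforward; by exists y|exact: (proj_lift_neq V)].
Qed.

Lemma lift_VR_lt nu r : VR_le Sn 6^-1 nu -> VR_lt RP r (pushforward (@proj R n) nu) ->
  VR_lt Sn r nu.
Proof.
move=> V Vr x y xnu ynu xy; rewrite (mdist_lift V)//.
apply: Vr; [apply/finsupp_pushforward; by exists x|
  apply/finsupp_pushforward; by exists y|exact: (proj_lift_neq V)].
Qed.

Lemma VR_le_proj_dot mu x y : VR_le RP 6^-1 mu ->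
  proj x \in finsupp mu -> proj y \in finsupp mu -> 2^-1 <= `|dot x y|.
Proof.
move=> V xmu ymu; rewrite -mdist_proj_le_sixth.
by have [->|xy] := eqVneq (proj x) (proj y); [rewrite mdistxx invr_ge0|exact: V].
Qed.

(* Otherwise the lift of [mu] through the representatives on the side of [x]
   has diameter at most 1/6. *)
Lemma lift_or_hexagon mu : VR_le RP 6^-1 mu ->
  (exists2 nu, VR_le Sn 6^-1 nu & pushforward (@proj R n) nu = mu) \/
  (exists x y z, [/\ proj x \in finsupp mu, proj y \in finsupp mu & proj z \in finsupp mu] /\
     [/\ 2^-1 <= dot x y, 2^-1 <= dot x z & dot y z <= - 2^-1]).
Proof.
(* The zero function serves only to extract a point of the support. *)
move=> V; have [p0 p0mu _] := exists_le_expect mu (fun=> 0).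
have [x x0] := proj_surj p0; rewrite {}x0 in p0mu.
pose L (p : RP) := if 2^-1 <= dot x (repr p) then repr p else antipode (repr p).
have LK p : proj (L p) = p.
  by rewrite /L; case: ifP => _; rewrite ?proj_antipode /proj reprK.
have xL p : p \in finsupp mu -> 2^-1 <= dot x (L p).
  move=> pmu; have := VR_le_proj_dot V p0mu (_ : proj (L p) \in finsupp mu).
  rewrite LK => /(_ pmu); rewrite /L; case: ifP => // xp.
  by rewrite dotNr normrN ler_normr xp.
have [close|/existsNP[p /existsNP[q]]] :=
  pselect (forall p q, p \in finsupp mu -> q \in finsupp mu -> 2^-1 <= dot (L p) (L q)).
  left; exists (pushforward L mu).
    move=> _ _ /finsupp_pushforward[p pmu <-] /finsupp_pushforward[q qmu <-] _.
    by rewrite mdist_le_sixth close.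
  by apply: expect_inj => g; rewrite !expect_pushforward; apply: eq_expect => p _ /=; rewrite LK.
move=> /not_implyP[pmu /not_implyP[qmu far]]; right; exists x, (L p), (L q).
rewrite !LK; split=> //; split; [exact: xL|exact: xL|].
(* Up to sign the scalar product is at least 1/2, so failing the bound makes it at most -1/2. *)
have := VR_le_proj_dot V (_ : proj (L p) \in finsupp mu) (_ : proj (L q) \in finsupp mu).
by rewrite !LK ler_normr => /(_ pmu qmu)/orP[//|]; rewrite lerNr.
Qed.

(* The squared norm of [y + z - x] is at most [3 - 3] under these bounds. *)
Lemma hexagon x y z : 2^-1 <= dot x y -> 2^-1 <= dot x z -> dot y z <= - 2^-1 ->
  [/\ val x = val y + val z, dot x y = 2^-1, dot x z = 2^-1 & dot y z = - 2^-1].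
Proof.
move=> xy xz yz; have := dot_ge0 (val y + val z - val x).
have e : dot (val y + val z - val x) (val y + val z - val x) =
    3 + 2 * dot y z - 2 * dot x y - 2 * dot x z.
  rewrite !(dotDl, dotDr, dotNl, dotNr) !sphere_dot1 (dotC z y) (dotC y x) (dotC z x).
  by ring.
rewrite e => ge0; split; [|lra..].
by apply/eqP; rewrite eq_sym -subr_eq0 -dot_eq0 e; apply/eqP; lra.
Qed.

Lemma mdist_eq_sixth x y : dot x y = 2^-1 -> mdist x y = 6^-1.
Proof.
move=> xy; have pi0 := pi_gt0 R.
have c0 : 2 * pi != 0 :> R by rewrite gt_eqF ?mulr_gt0.
apply: (mulfI c0); rewrite mdistE xy -cos_sixth cosK// in_itv/=.
by apply/andP; split; lra.
Qed.

(** The exceptional configuration contains two points at distance exactly 1/6, which the strict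
    bound excludes. *)
Lemma VR_lt_lift mu : VR_lt RP 6^-1 mu ->
  exists2 nu, VR_le Sn 6^-1 nu & pushforward (@proj R n) nu = mu.
Proof.
move=> V; have V6 : VR_le RP 6^-1 mu by move=> p q pmu qmu pq; apply: ltW; exact: V.
have [//|[x [y [z [[xmu ymu _] [xy xz yz]]]]]] := lift_or_hexagon V6.
have [_ /mdist_eq_sixth xyE _ _] := hexagon xy xz yz.
have : mdist (proj x) (proj y) < 6^-1.
  have [->|pxy] := eqVneq (proj x) (proj y); last exact: V.
  by rewrite mdistxx invr_gt0.
by rewrite mdist_proj_near xyE ?ltxx.
Qed.

(** Pairing a linear relation with [y] and [z] gives a Gram system of determinant 3/4. *)
Lemma row_free_hexagon y z : dot y z = - 2^-1 -> row_free (col_mx (val y) (val z)).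
Proof.
move=> yz; rewrite -kermx_eq0; apply/rowV0P => v /sub_kermxP.
rewrite -[v]hsubmxK mul_row_col; set a := lsubmx v; set b := rsubmx v.
rewrite [a]mx11_scalar [b]mx11_scalar !mul_scalar_mx => e.
have ey := congr1 (dot (val y)) e; have ez := congr1 (dot (val z)) e.
move: ey ez; rewrite !dotDr !dotZr !sphere_dot1 (dotC z y) yz !(dotC _ 0) !dot0l.
move: (a 0 0) (b 0 0) => c d ey ez.
have [-> ->] : c = 0 /\ d = 0 by split; lra.
by rewrite -scalemx1 scale0r row_mx0.
Qed.

(** As [x = y + z], the points [x], [y], [z] and their antipodes form a regular hexagon in the plane
    of [y] and [z]; its three diagonals are the points of the triangle. *)
Lemma hexagon_W mu x y z : VR_le RP 6^-1 mu ->
  proj x \in finsupp mu -> proj y \in finsupp mu -> proj z \in finsupp mu ->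
  2^-1 <= dot x y -> 2^-1 <= dot x z -> dot y z <= - 2^-1 -> @W R n mu.
Proof.
move=> V xmu ymu zmu xy xz yz.
have [xE xyE xzE yzE] := hexagon xy xz yz.
have dxy : mdist (proj x) (proj y) = 6^-1.
  by rewrite mdist_proj_near mdist_eq_sixth.
have dxz : mdist (proj x) (proj z) = 6^-1.
  by rewrite mdist_proj_near mdist_eq_sixth.
have dyz : mdist (proj y) (proj z) = 6^-1.
  (* [antipode z] is the representative close to [y]. *)
  have h : mdist y (antipode z) = 6^-1.
    by apply: mdist_eq_sixth; rewrite /= dotNr yzE opprK.
  by rewrite -(proj_antipode z) mdist_proj_near h.
have neq p q : mdist p q = 6^-1 -> (p == q :> RP) = false.
  by move=> pq; apply/eqP => e; move: pq; rewrite e mdistxx; lra.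
exists (proj x), (proj y), (proj z); split; last first.
  apply: eq_fset3 => // p; have [t ->] := proj_surj p => tmu.
  have := VR_le_proj_dot V tmu ymu; have := VR_le_proj_dot V tmu zmu.
  have := VR_le_proj_dot V tmu xmu; rewrite xE dotDr.
  set a := dot t y; set b := dot t z => ab b2 a2.
  (* If [a] and [b] have the same sign, their sum has absolute value at least 1; otherwise the
     larger of [|a|] and [|b|] exceeds the smaller by at least 1/2, hence is at least 1. *)
  suff : [|| 1 <= `|a + b|, 1 <= `|a| | 1 <= `|b|].
    rewrite {1}/a {1}/b -dotDr -xE.
    by case/or3P => /proj_dot_eq1 ->; [apply: Or31|apply: Or32|apply: Or33].
  move: ab b2 a2; rewrite !ler_normr => /orP[]? /orP[]? /orP[]?; lra.
split; last by rewrite dxy dyz dxz.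
- exists (@proj R n @` [set u : Sn | (val u <= col_mx (val y) (val z))%MS]).
    by exists (col_mx (val y) (val z)) => //; exact: row_free_hexagon.
  have ys : (val y <= col_mx (val y) (val z))%MS by rewrite -addsmxE addsmxSl.
  have zs : (val z <= col_mx (val y) (val z))%MS by rewrite -addsmxE addsmxSr.
  by split; [exists x; rewrite //= xE addmx_sub|exists y|exists z].
- by rewrite uniq3 !neq.
Qed.

Lemma VR_le_lift mu : VR_le RP 6^-1 mu -> ~ @W R n mu ->
  exists2 nu, VR_le Sn 6^-1 nu & pushforward (@proj R n) nu = mu.
Proof.
move=> V nW; have [//|[x [y [z [[xmu ymu zmu] [xy xz yz]]]]]] := lift_or_hexagon V.
by case: nW; exact: (hexagon_W V xmu ymu zmu).
Qed.

(** Three vectors of a plane are dependent, so their Gram matrix is singular; its eigenvalues are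
    [1 + 2 c] and [1 - c]. The proof pairs a relation with each vector and adds up. *)
Lemma coplanar_equiangular x y z (U : 'M[R]_(2, n.+1)) c :
  [/\ (val x <= U)%MS, (val y <= U)%MS & (val z <= U)%MS] ->
  [/\ dot x y = c, dot y z = c & dot x z = c] -> c != 1 -> c = - 2^-1.
Proof.
move=> [xU yU zU] [xy yz xz] c1.
pose Y := col_mx (val x) (col_mx (val y) (val z)).
have : ~~ row_free Y.
  rewrite -row_leq_rank -ltnNge; apply: (@leq_ltn_trans (\rank U)); last by rewrite ltnS rank_leq_row.
  by apply: mxrankS; rewrite -addsmxE addsmx_sub xU -addsmxE addsmx_sub yU.
rewrite -kermx_eq0 => /rowV0Pn[v /sub_kermxP].
rewrite -[v]hsubmxK -[rsubmx v]hsubmxK !mul_row_col.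
set a := lsubmx v; set b := lsubmx _; set d := rsubmx _.
rewrite [a]mx11_scalar [b]mx11_scalar [d]mx11_scalar !mul_scalar_mx => e v0.
have ex := congr1 (dot (val x)) e; have ey := congr1 (dot (val y)) e.
have ez := congr1 (dot (val z)) e.
move: ex ey ez v0; rewrite !dotDr !dotZr !sphere_dot1 (dotC z y) (dotC y x) (dotC z x).
rewrite xy yz xz !(dotC _ 0) !dot0l.
move: (a 0 0) (b 0 0) (d 0 0) => i j k ex ey ez.
have e0 : (1 + 2 * c) * (i + j + k) = 0.
  by rewrite -[RHS](addr0 0) -{1}[0](addr0 0) -{1}ex -{1}ey -ez; ring.
have [/eqP|s0] := eqVneq (i + j + k) 0; last first.
  by move/eqP: e0; rewrite mulf_eq0 (negPf s0) orbF => /eqP ? _; lra.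
move=> /eqP s0; have c0 : 1 - c != 0 by rewrite subr_eq0 eq_sym.
have zero l : (1 - c) * l = 0 -> l = 0.
  by move/eqP; rewrite mulf_eq0 (negPf c0) => /eqP.
have [-> -> ->] : [/\ i = 0, j = 0 & k = 0].
  have cs : c * (i + j + k) = 0 by rewrite s0 mulr0.
  split; apply: zero.
  - by rewrite -[RHS](subrr 0) -{1}ex -cs; ring.
  - by rewrite -[RHS](subrr 0) -{1}ey -cs; ring.
  - by rewrite -[RHS](subrr 0) -{1}ez -cs; ring.
by rewrite -scalemx1 scale0r !row_mx0 eqxx.
Qed.

(** Lifts of the three vertices would be coplanar with a common scalar product, both at least 1/2
    and equal to -1/2. *)
Lemma pushforward_notin_W nu : VR_le Sn 6^-1 nu -> ~ @W R n (pushforward (@proj R n) nu).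
Proof.
move=> V [p0 [p1 [p2 [[[C [U _ ->] [C0 C1 C2]] un [d01 d12]] supp]]]].
have lift p : p \in [fset p0; p1; p2]%fset ->
    exists2 x, x \in finsupp nu & proj x = p.
  by rewrite -supp => /finsupp_pushforward.
(* The plane is stable under negation, so it contains both representatives. *)
have inU x : (@proj R n @` [set u : Sn | (val u <= U)%MS]) (proj x) -> (val x <= U)%MS.
  by case=> u /= uU /eq_proj[<-//|e]; rewrite -(antipodeK x) -e/= (eqmx_opp _).
have [x xnu xp] : exists2 x, x \in finsupp nu & proj x = p0.
  by apply: lift; rewrite in_fset3 eqxx.
have [y ynu yp] : exists2 x, x \in finsupp nu & proj x = p1.
  by apply: lift; rewrite in_fset3 eqxx orbT.
have [z znu zp] : exists2 x, x \in finsupp nu & proj x = p2.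
  by apply: lift; rewrite in_fset3 eqxx !orbT.
subst p0 p1 p2; move: d01 d12; rewrite -!(mdist_lift V)// => d01 d12.
have yzE : dot y z = dot x y by rewrite -!cos_mdist d01.
have xzE : dot x z = dot x y by rewrite -!cos_mdist -d12 d01.
have c1 : dot x y != 1.
  apply: contraL un => /eqP e; have -> : x = y by apply: sphere_dot_eq1; rewrite e.
  by rewrite uniq3 eqxx.
have := VR_le_dot V xnu ynu.
by rewrite (@coplanar_equiangular x y z U (dot x y))//; [lra|split; exact: inU].
Qed.

End Lifting.

(** * A Lipschitz substitute for the sign *)

Section SignCutoff.
Context (R : realType).
Implicit Types s t : R.

(* Chosen odd, Lipschitz and equal to the sign outside [-1/2, 1/2]. *)
Definition sign_cutoff s : R := `|s + 2^-1| - `|s - 2^-1|.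

Lemma sign_cutoffN s : sign_cutoff (- s) = - sign_cutoff s.
Proof.
by rewrite /sign_cutoff opprB -(normrN (- s + _)) -(normrN (- s - _)) !opprD !opprK.
Qed.

Lemma sign_cutoff1 s : 2^-1 <= s -> sign_cutoff s = 1.
Proof. by move=> s2; rewrite /sign_cutoff !ger0_norm; lra. Qed.

Lemma sign_cutoff_le1 s : `|sign_cutoff s| <= 1.
Proof.
apply: le_trans (ler_dist_dist _ _) _; rewrite (_ : _ - _ = 1) ?normr1//.
by lra.
Qed.

Lemma sign_cutoff_lipschitz s t : `|sign_cutoff s - sign_cutoff t| <= 2 * `|s - t|.
Proof.
have e : sign_cutoff s - sign_cutoff t =
    (`|s + 2^-1| - `|t + 2^-1|) - (`|s - 2^-1| - `|t - 2^-1|).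
  by rewrite /sign_cutoff; ring.
rewrite e; apply: le_trans (ler_normB _ _) _.
rewrite mulr_natl mulr2n; apply: lerD; apply: le_trans (ler_dist_dist _ _) _.
  by rewrite opprD addrACA subrr addr0.
by rewrite opprB addrA subrK.
Qed.

End SignCutoff.

(** * A continuity estimate for the radial projection of barycenters *)

Section PifContinuous.
Context (R : realType) (n : nat).
Let Sn := sphere R n.
Let RP := projective_space R n.
Implicit Types (x y z : Sn) (p q : RP) (nu : fsprob R Sn) (mu : fsprob R RP).

(* The cutoff makes the kernel invariant under changes of representatives.
   On pairs of points at distance at most 1/6 with lifts as close, it is
   [dot y z - dot x y * dot x z], whose expectation is [|m|^2 - (dot x m)^2]
   for the barycenter [m]; so [m] is compared with [x] without choosing a lift
   continuously. *)
Definition angle_kernel x p q : R :=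
  sign_cutoff (dot (repr p) (repr q)) *
  (dot (repr p) (repr q) - dot x (repr p) * dot x (repr q)).

(** Replacing [y] or [z] by its antipode changes the sign of both factors. *)
Lemma angle_kernel_proj x y z : angle_kernel x (proj y) (proj z) =
  sign_cutoff (dot y z) * (dot y z - dot x y * dot x z).
Proof.
rewrite /angle_kernel.
have /eq_proj[->|->] : proj (repr (proj y)) = proj y by rewrite /proj reprK.
all: have /eq_proj[->|->] : proj (repr (proj z)) = proj z by rewrite /proj reprK.
all: rewrite /= ?(dotNl, dotNr) ?opprK ?sign_cutoffN //; ring.
Qed.

Lemma angle_kernelC x p q : angle_kernel x p q = angle_kernel x q p.
Proof. by rewrite /angle_kernel dotC [dot x _ * _]mulrC. Qed.

(** The constant is [2 * (2 pi) * 2], from the 2-Lipschitz cutoff times a factor bounded by 2, plus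
    [4 pi] from the variation of that factor. *)
Lemma angle_kernel_lipschitz x p q q' :
  `|angle_kernel x p q - angle_kernel x p q'| <= 12 * pi * mdist q q'.
Proof.
have [[y ->] [z ->]] := (proj_surj p, proj_surj q).
(* The representative of [q'] is the one that attains the minimum in the projective distance. *)
have [z' -> ->] : exists2 z', q' = proj z' & mdist (proj z) q' = mdist z z'.
  have [w ->] := proj_surj q'; rewrite mdist_proj minEle; case: ifP => _.
    by exists w.
  by exists (antipode w); rewrite ?proj_antipode.
rewrite !angle_kernel_proj.
have := dot_lipschitz y z z'; have := dot_lipschitz x z z'.
have := sphere_dot_norm y z; have := sphere_dot_norm x y.
have := sphere_dot_norm x z.
set a := dot y z; set a' := dot y z'; set b := dot x y; set c := dot x z.
set c' := dot x z'; set d := mdist z z' => c1 b1 a1 cc aa.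
have -> : sign_cutoff a * (a - b * c) - sign_cutoff a' * (a' - b * c') =
  (sign_cutoff a - sign_cutoff a') * (a - b * c) +
  sign_cutoff a' * ((a - a') - b * (c - c')) by ring.
apply: le_trans (ler_normD _ _) _; rewrite !normrM.
have h1 : `|sign_cutoff a - sign_cutoff a'| <= 2 * (2 * pi * d).
  by apply: le_trans (sign_cutoff_lipschitz _ _) _; rewrite ler_pM2l.
have h2 : `|a - b * c| <= 2.
  apply: le_trans (ler_normB _ _) _; rewrite normrM (_ : 2 = 1 + 1 :> R)//.
  by apply: lerD => //; rewrite mulr_ile1.
have h3 : `|(a - a') - b * (c - c')| <= 2 * pi * d + 2 * pi * d.
  apply: le_trans (ler_normB _ _) _; apply: lerD => //; rewrite normrM.
  by apply: le_trans cc; rewrite ler_piMl.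
have -> : 12 * pi * d = 2 * (2 * pi * d) * 2 + 1 * (2 * pi * d + 2 * pi * d) by ring.
by apply: lerD; apply: ler_pM => //; exact: sign_cutoff_le1.
Qed.

Lemma expect_angle_kernel x nu : VR_le Sn 6^-1 nu ->
  let mu := pushforward (@proj R n) nu in let m := barycenter nu in
  expect mu (fun p => expect mu (angle_kernel x p)) = dot m m - dot x m ^+ 2.
Proof.
move=> V; rewrite /= expect_pushforward.
transitivity (expect nu (fun y => dot y (barycenter nu) - dot x (barycenter nu) * dot x y)).
  apply: eq_expect => y ynu; rewrite /= expect_pushforward !dot_barycenter.
  rewrite [_ * dot x y]mulrC -expectZ -expectB; apply: eq_expect => z znu /=.
  by rewrite angle_kernel_proj sign_cutoff1 ?mul1r// (VR_le_dot V).
rewrite expectB expectZ -dot_barycenter expr2; congr (_ - _).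
by rewrite [RHS]dot_barycenter; apply: eq_expect => y _; rewrite dotC.
Qed.

(** The left side is the squared sine of the angle between two lines. The kernel expectation
    vanishes for [nu], hence is at most [24 pi] times the distance for [nu']; dividing by a squared
    norm of at least 1/2 doubles the constant. *)
Lemma radial_dot_close nu nu' : VR_le Sn 6^-1 nu -> VR_le Sn 6^-1 nu' ->
  1 - dot (radial (barycenter nu)) (radial (barycenter nu')) ^+ 2 <=
  48 * pi * wasserstein (pushforward (@proj R n) nu) (pushforward (@proj R n) nu').
Proof.
move=> V V'; set x := radial (barycenter nu).
have L0 : 0 < 12 * pi :> R by rewrite mulr_gt0 ?pi_gt0.
have := expect2_lipschitz (pushforward (@proj R n) nu) (pushforward (@proj R n) nu')
  L0 (angle_kernelC x) (angle_kernel_lipschitz x).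
rewrite !expect_angle_kernel//; set w := wasserstein _ _.
have sq (k : fsprob R Sn) : VR_le Sn 6^-1 k ->
    Num.sqrt (dot (barycenter k) (barycenter k)) ^+ 2 = dot (barycenter k) (barycenter k).
  by move=> _; rewrite sqr_sqrtr ?dot_ge0.
have m0 := barycenter_norm_ge V; have m0' := barycenter_norm_ge V'.
have -> : dot (barycenter nu) (barycenter nu) - dot x (barycenter nu) ^+ 2 = 0.
  rewrite /x (dot_radial _ V) expr_div_n sq//.
  by field; apply/eqP; lra.
rewrite sub0r normrN (dotC x (radial _)) (dot_radial _ V') expr_div_n sq// (dotC _ x).
set m := dot (barycenter nu') _; set d := dot x _ => /(le_trans (ler_norm _)) le.
have -> : 1 - d ^+ 2 / m = (m - d ^+ 2) / m by field; apply/eqP; rewrite /m; lra.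
rewrite ler_pdivrMr; last by rewrite /m; lra.
apply: (le_trans le); have w0 : 0 <= w := wasserstein_ge0 _ _.
have -> : 2 * (12 * pi) * w = 48 * pi * w * 2^-1 by field.
by rewrite ler_wpM2l// mulr_ge0// mulr_ge0 ?pi_ge0.
Qed.

Lemma eighth_angle (e : R) : 0 < e -> e <= 8^-1 -> 0 < 2 * pi * e <= pi / 4.
Proof.
move=> e0 e8; have pi0 := pi_gt0 R; have pi2 : 0 < 2 * pi :> R by lra.
rewrite mulr_gt0//=; have : 2 * pi * e <= 2 * pi * 8^-1 by rewrite ler_pM2l.
by lra.
Qed.

(** A small squared sine puts [x] near [y] or near its antipode, which is all that the projective
    distance asks. *)
Lemma mdist_proj_lt x y e : 0 < e -> e <= 8^-1 ->
  1 - dot x y ^+ 2 < sin (2 * pi * e) ^+ 2 -> mdist (proj x) (proj y) < e.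
Proof.
move=> e0 e8; rewrite sin2cos2 ltrD2l ltrN2 => lt; rewrite mdist_proj gt_min.
have /andP[a0 a4] := eighth_angle e0 e8; have pi0 := pi_gt0 R.
have c0 : 0 <= cos (2 * pi * e).
  by apply: cos_ge0_pihalf; apply/andP; split; lra.
have : cos (2 * pi * e) < `|dot x y|.
  by rewrite -ltr_sqr ?nnegrE// real_normK ?num_real.
have lt_e z : cos (2 * pi * e) < dot x z -> mdist x z < e.
  move=> cz; rewrite lt_neqAle mdist_leE ?(ltW cz) ?andbT; last first.
    by apply/andP; split; lra.
  by apply: contraTneq cz => <-; rewrite cos_mdist ltxx.
rewrite ltr_normr => /orP[/lt_e -> //|]; rewrite -dotNr => h.
by rewrite (lt_e (antipode y))// orbT.
Qed.

End PifContinuous.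

(** * The homotopy equivalence for a general pair of thickenings *)

Section PifHomotopyEquivalence.
Context (R : realType) (n : nat).
Let Sn := sphere R n.
Let RP := projective_space R n.

Lemma near_mdist (X : topologicalType) (Y : metricType R) (f : X -> Y) x e :
  {for x, continuous f} -> 0 < e -> \forall x' \near x, mdist (f x) (f x') < e.
Proof. by move=> fx e0; apply: metricType_numDomainType.cvgr_dist_lt. Qed.

Lemma continuous_mdist (X : topologicalType) (Y : metricType R) (f : X -> Y) :
  (forall x e, 0 < e -> \forall x' \near x, mdist (f x) (f x') < e) -> continuous f.
Proof. by move=> H x; apply/metricType_numDomainType.cvgrPdist_lt => e; exact: H. Qed.

(** [B] carries the topology induced by the inclusion, so continuity is tested in the ambient
    metric. *)
Lemma continuous_set_type (X : topologicalType) (Y : metricType R) (B : set Y)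
    (f : X -> B) :
  (forall x e, 0 < e -> \forall x' \near x, mdist (set_val (f x)) (set_val (f x')) < e) ->
  continuous f.
Proof. by move=> H; apply/continuous_comp_initial/continuous_mdist. Qed.

(** An arbitrary pair treats all scales, strict or not, at once; the theorem then only checks the
    hypotheses. *)
Context (A : set (fsprob R Sn)) (B : set (fsprob R RP)).
Hypothesis A_near : A `<=` VR_le Sn 6^-1.
Hypothesis AB : forall mu, B mu <-> exists2 nu, A nu & pushforward (@proj R n) nu = mu.

Let lift (mu : B) : exists2 nu, A nu & pushforward (@proj R n) nu = set_val mu.
Proof. exact: (AB _).1 (set_valP mu). Qed.

Lemma continuous_pif : continuous (@pif R n A B).
Proof.
apply: (@continuous_mdist B RP) => mu eps eps0.
have [nu Anu numu] := lift mu.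
(* The cap 1/8 keeps the angle [2 pi e] at most [pi/4], where sine and cosine are positive. *)
pose e : R := Num.min eps 8^-1.
have e0 : 0 < e by rewrite lt_min eps0 invr_gt0 ltr0n.
have s0 : 0 < sin (2 * pi * e) ^+ 2.
  have e8 : e <= 8^-1 by rewrite ge_min lexx orbT.
  have /andP[a0 a4] := eighth_angle e0 e8; have pi0 := pi_gt0 R.
  by rewrite exprn_gt0// sin_gt0_pi//; apply/andP; split; lra.
(* This radius is what [radial_dot_close] turns into the bound [sin (2 pi e) ^+ 2]. *)
have d0 : 0 < sin (2 * pi * e) ^+ 2 / (48 * pi) by rewrite divr_gt0// mulr_gt0 ?pi_gt0.
have c : {for mu, continuous (set_val : B -> fsprob R RP)} by exact: initial_continuous.
have := near_mdist c d0.
apply: filterS => mu'; have [nu' Anu' numu'] := lift mu'.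
rewrite (pifE A_near Anu numu) (pifE A_near Anu' numu').
rewrite ltr_pdivlMr ?mulr_gt0 ?pi_gt0// mulrC -numu -numu' => lt.
apply: (@lt_le_trans _ _ e); last by rewrite ge_min lexx.
apply: mdist_proj_lt => //; first by rewrite ge_min lexx orbT.
exact: le_lt_trans (radial_dot_close (A_near Anu) (A_near Anu')) lt.
Qed.

Hypothesis A_dirac : forall x, A (dirac_fsprob R x).
Hypothesis A_cone : forall nu t, A nu -> A (cone t nu (radial (barycenter nu))).

Let B_dirac p : B (dirac_fsprob R p).
Proof.
have [x ->] := proj_surj p; apply/AB; exists (dirac_fsprob R x) => //.
exact: pushforward_dirac.
Qed.

(** Membership is checked on a lift, where the segment stays in [A]; projecting commutes with
    [cone]. *)
Let B_cone (mu : B) t : B (cone t (set_val mu) (pif A mu)).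
Proof.
have [nu Anu numu] := lift mu; rewrite (pifE A_near Anu numu); apply/AB.
exists (cone t nu (radial (barycenter nu))); first exact: A_cone.
by rewrite pushforward_cone numu.
Qed.

Let dirac_point p : B := exist (fun mu => mu \in B) _ (mem_set (B_dirac p)).

Let deform (z : B * R) : B := exist (fun mu => mu \in B) _ (mem_set (B_cone z.1 z.2)).

(** A unit vector is its own barycenter and its own radial projection. *)
Lemma pif_dirac_point p : pif A (dirac_point p) = p.
Proof.
have [x xp] := proj_surj p.
have e : pushforward (@proj R n) (dirac_fsprob R x) = \val (dirac_point p).
  by rewrite pushforward_dirac -xp.
rewrite (pifE A_near (A_dirac x) e) [RHS]xp; congr proj.
have -> : barycenter (dirac_fsprob R x) = val x.
  by apply/rowP => i; rewrite barycenterE expect_dirac.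
apply: val_inj; rewrite radial_val; first by rewrite sphere_dot1 sqrtr1 invr1 scale1r.
by rewrite -dot_eq0 sphere_dot1 oner_eq0.
Qed.

Lemma pif_homotopy_equivalence : homotopy_equivalence R (@pif R n A B).
Proof.
split; first exact: continuous_pif.
exists dirac_point; split.
- apply: continuous_set_type => p e e0.
  have := near_mdist (@cvg_id _ (nbhs p)) e0; apply: filterS => q.
  by apply: le_lt_trans; rewrite /dirac_point /=; exact: wasserstein_dirac.
- exists deform; split.
  + apply: continuous_subspaceT; apply: continuous_set_type => -[mu t] e e0.
    have e3 : 0 < e / 3 by rewrite divr_gt0.
    have c1 : {for (mu, t), continuous (fun z : B * R => set_val z.1)}.
      apply: (@continuous_comp _ _ _ fst set_val); first exact: cvg_fst.
      exact: initial_continuous.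
    have c2 : {for (mu, t), continuous (fun z : B * R => pif A z.1)}.
      apply: (@continuous_comp _ _ _ fst (@pif R n A B)); first exact: cvg_fst.
      exact: continuous_pif.
    have n3 : \forall z \near (mu, t), `|t - z.2| < e / 3.
      apply: (@cvg_snd _ _ (nbhs mu) (nbhs (t : R)) _ (ball (t : R) (e / 3))).
      exact: nbhsx_ballx.
    near=> z.
    (* The measure and the apex change first, then the time; each of the three gets a third of [e].
       The diameter of the projective space is at most 1/2, so the change of time costs at most
       [|t - z.2|]. *)
    apply: le_lt_trans (@wasserstein_triangle _ _ (cone t (set_val z.1) (pif A z.1)) _ _) _.
    rewrite (_ : e = e / 3 + e / 3 + e / 3); last by field.
    apply: ltrD.
      apply: le_lt_trans (wasserstein_cone _ _ _ _ _) _; apply: ltrD.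
        by near: z; exact: (near_mdist c1).
      by near: z; exact: (near_mdist c2).
    apply: le_lt_trans (wasserstein_cone_time _ _ _ _ (@mdist_proj_le_half R n)) _.
    apply: (@le_lt_trans _ _ `|t - z.2|); first by rewrite ler_piMr// invf_le1 ?ler1n.
    by near: z.
  + by move=> mu; apply: val_inj => /=; rewrite cone0.
  + by move=> mu; apply: val_inj => /=; rewrite cone1.
(* This composite is the identity, so the constant homotopy works. *)
- exists fst; split; first by apply: continuous_subspaceT => z; exact: cvg_fst.
  + by move=> p /=; rewrite pif_dirac_point.
  + by [].
Unshelve. all: by end_near.
Qed.

End PifHomotopyEquivalence.

Theorem theorem4p5 (R : realType) (n : nat) (n_ge1 : (1 <= n)%N) :
  [/\ forall r : R, 0 <= r -> r < 6^-1 ->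
        homotopy_equivalence R (@pif R n
          (VR_lt (sphere R n) r) (VR_lt (projective_space R n) r)) /\
        homotopy_equivalence R (@pif R n
          (VR_le (sphere R n) r) (VR_le (projective_space R n) r)),
      homotopy_equivalence R (@pif R n
        (VR_lt (sphere R n) 6^-1) (VR_lt (projective_space R n) 6^-1)) &
      homotopy_equivalence R (@pif R n
        (VR_le (sphere R n) 6^-1)
        (VR_le (projective_space R n) 6^-1 `\` @W R n))].
Proof.
(* A point mass has no two distinct support points, so it lies in every thickening, even the strict
   one at scale 0. *)
have dirac_le r x : VR_le (sphere R n) r (dirac_fsprob R x).
  by move=> y z; rewrite !finsupp_dirac => /eqP -> /eqP ->; rewrite eqxx.
have dirac_lt r x : VR_lt (sphere R n) r (dirac_fsprob R x).
  by move=> y z; rewrite !finsupp_dirac => /eqP -> /eqP ->; rewrite eqxx.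
have lt_le6 r : r <= 6^-1 -> VR_lt (sphere R n) r `<=` VR_le (sphere R n) 6^-1.
  by move=> r6 nu V x y xnu ynu xy; apply: le_trans (ltW (V _ _ _ _ _)) r6.
have heq_lt r : r <= 6^-1 -> homotopy_equivalence R (@pif R n
    (VR_lt (sphere R n) r) (VR_lt (projective_space R n) r)).
  move=> r6; apply: pif_homotopy_equivalence => //; first exact: lt_le6.
    move=> mu; split=> [V|[nu V <-]]; last exact: pushforward_VR_lt.
    (* A lift is found at scale 1/6 and then shown to have scale [r]. *)
    have [nu nuV numu] : exists2 nu, VR_le (sphere R n) 6^-1 nu &
        pushforward (@proj R n) nu = mu.
      by apply: VR_lt_lift => p q pmu qmu pq; apply: lt_le_trans r6; exact: V.
    by exists nu => //; apply: lift_VR_lt => //; rewrite numu.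
  by move=> nu t; exact: VR_lt_cone.
split=> [r _ r6||]; [split; first exact/heq_lt/ltW|exact: heq_lt|].
- apply: pif_homotopy_equivalence => //.
  + by move=> nu V x y xnu ynu xy; apply: le_trans (V _ _ _ _ _) (ltW r6).
  + move=> mu; split=> [V|[nu V <-]]; last exact: pushforward_VR_le.
    (* Since [r < 1/6], the strict lifting result applies and [W] does not intervene. *)
    have [nu nuV numu] : exists2 nu, VR_le (sphere R n) 6^-1 nu &
        pushforward (@proj R n) nu = mu.
      by apply: VR_lt_lift => p q pmu qmu pq; apply: le_lt_trans r6; exact: V.
    by exists nu => //; apply: lift_VR_le => //; rewrite numu.
  + by move=> nu t; apply: VR_le_cone; exact: ltW.
- apply: pif_homotopy_equivalence => //.
  (* [W] is exactly the obstruction: outside it lifts exist, and no projected measure lies in it. *)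
  + move=> mu; split=> [[V nW]|[nu V <-]].
      by have [nu nuV numu] := VR_le_lift V nW; exists nu.
    by split; [exact: pushforward_VR_le|exact: pushforward_notin_W].
  + by move=> nu t; exact: VR_le_cone.
Qed.
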